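(* If $\sigma(A)\cap i\mathbf R$ is countable, then $\lim_{t\to\infty}\frac{\|T(t)x\|}{u(t)}=0$ for each $x\in X$, provided one of the following conditions is satisfied: (a) $P\sigma(A')\cap i\mathbf R=\emptyset$; (b) $\mathrm{range}(A-is)$ is dense in $X$ for each $s\in\mathbf R$; (c) either $v$ or $w$ is unbounded, $v$ is constant or $\frac1v\in C_{w,0}(\mathbf R_+,\mathbf R)$, and $\ker(A-is)+\mathrm{range}(A-is)$ is dense in $X$ for each $s\in\mathbf R$.
   Context: $X$ is a complex Banach space and $A$ is the generator of a $C_0$-semigroup $\{T(t):t\in\mathbf R_+\}$ of bounded operators on $X$; $\sigma(A)$ is the spectrum of $A$, $A'$ is the conjugate (adjoint) of $A$ and $P\sigma(A')$ the point spectrum of $A'$. It is assumed that $\|T(t)\|\le u(t)$ for all $t\in\mathbf R_+=[0,\infty)$, where $u=vw$ and $v,w$ are as follows. For a function $g$: $\Delta_hg(t)=g(t+h)-g(t)$. $w:\mathbf R\to\mathbf R$ is a weight, i.e. a continuous function with $w\ge 1$, $w(s+t)\le w(s)w(t)$, $w(-t)=w(t)$, $\sum_{n\ge1}n^{-2}\log w(nt)<\infty$ for all $s,t$; $w=1$ or $1/w\in C_0(\mathbf R)$; $\Delta_hw/w\in C_0(\mathbf R)$ for every $h$; $\sup_t|\Delta_hw(t)|/w(t)\to0$ as $h\to0$ (a bounded weight is assumed to be $1$); and $w$ has polynomial growth of some order $N\in\mathbf Z_+$: $\lim_{|m|\to\infty}w(mt)/(1+|m|^{N+1})=0$ for all $t\in\mathbf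 R$ and $\inf_{m\in\mathbf Z}w(mt)/|m|^N>0$ for some $t$. $v:\mathbf R\to[1,\infty)$ is continuous with $v(s+t)\le v(s)v(t)$; $\Delta_hv/v\in C_0(\mathbf R)$ for every $h$; $\sup_t|\Delta_hv(t)|/v(t)\to0$ as $h\to0$; $v$ is differentiable on $\mathbf R_+$ and $v'/v\in C_0(\mathbf R_+,\mathbf R)$. $C_{w,0}(\mathbf R_+,\mathbf R)=\{w\xi:\xi\in C_0(\mathbf R_+,\mathbf R)\}$. *)

(* Defs.v *)
From HB Require Import structures.
From mathcomp Require Import all_boot all_order all_algebra.
From mathcomp Require Export complex.
From mathcomp Require Import all_classical all_reals all_analysis.

Set Implicit Arguments.
Unset Strict Implicit.
Unset Printing Implicit Defensive.

Import Order.TTheory GRing.Theory Num.Theory.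
Import numFieldNormedType.Exports.

Local Open Scope classical_set_scope.
Local Open Scope complex_scope.
Local Open Scope ring_scope.

Section RealFunctions.
Variable R : realType.
Implicit Types (f g v w : R -> R).

Definition Delta (h : R) g : R -> R := fun t => g (t + h) - g t.

(* Only real-valued functions occur, so C_0(R) is taken real-valued. *)
Definition C0 f : Prop :=
  [/\ continuous f, f t @[t --> +oo] --> 0 & f t @[t --> -oo] --> 0].

(* Functions on R_+ are functions on R of which only the values on [0, +oo[
   are looked at. *)
Definition C0_Rplus f : Prop :=
  {within `[0, +oo[, continuous f} /\ f t @[t --> +oo] --> 0.

Definition Cw0_Rplus w : set (R -> R) :=
  [set f | exists xi, C0_Rplus xi /\ forall t : R, 0 <= t -> f t = w t * xi t].

Definition bounded_function f : Prop := [bounded f t | t in [set: R]].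

(* The real supremum below is a genuine one: its set is nonempty, and bounded
   because of the first clause. *)
Definition small_increments g : Prop :=
  (forall h, C0 (fun t => Delta h g t / g t)) /\
  sup [set `|Delta h g t| / g t | t in [set: R]] @[h --> 0^'] --> 0.

(* In the second clause m = 0 is left out: there w (m t) / |m|^N is infinite
   if N > 0 (whereas division by 0 gives 0 here), and it is w 0 >= 1 if N = 0,
   so it does not affect the positivity of the infimum. *)
Definition polynomial_growth w (N : nat) : Prop :=
  (forall t e : R, 0 < e -> exists M : nat, forall m : int, (M <= `|m|)%N ->
     `|w (m%:~R * t) / (1 + `|m%:~R| ^+ N.+1)| < e) /\
  (exists t : R,
     0 < inf [set w (m%:~R * t) / `|m%:~R| ^+ N | m in [set m : int | m != 0]]).

Record weight w : Prop := Weight {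
  weight_continuous : continuous w;
  weight_ge1 : forall t, 1 <= w t;
  weight_submult : forall s t, w (s + t) <= w s * w t;
  weight_sym : forall t, w (- t) = w t;
  weight_nonquasianalytic : forall t,
    (\sum_(1 <= n <oo) (ln (w (n%:R * t)) / n%:R ^+ 2)%:E < +oo)%E;
  weight_one_or_C0 : w = cst 1 \/ C0 (fun t => 1 / w t);
  weight_bounded : bounded_function w -> w = cst 1;
  weight_increments : small_increments w;
  weight_growth : exists N, polynomial_growth w N }.

(* v is differentiable on [0, +oo[ as a function on that half-line (one-sided
   derivative at 0); dv is its derivative there. *)
Record admissible v : Prop := Admissible {
  admissible_continuous : continuous v;
  admissible_ge1 : forall t, 1 <= v t;
  admissible_submult : forall s t, v (s + t) <= v s * v t;
  admissible_increments : small_increments v;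
  admissible_derivative : exists dv : R -> R,
    (forall t : R, 0 <= t ->
       (v s - v t) / (s - t) @[s --> within [set s | 0 <= s] t^'] --> dv t) /\
    C0_Rplus (fun t => dv t / v t) }.

End RealFunctions.

Section Operators.
Variable R : realType.

(* The norm of a normed module over R[i] takes its values in R[i]. *)
Definition rnorm (V : normedModType R[i]) (x : V) : R := complex.Re `|x|.

Definition bounded_linear (V W : normedModType R[i]) (S : V -> W) : Prop :=
  linear S /\ exists M : R, forall x, rnorm (S x) <= M * rnorm x.

Definition opnorm (V W : normedModType R[i]) (S : V -> W) : R :=
  sup [set rnorm (S x) | x in [set x | rnorm x <= 1]].

Variable X : normedModType R[i].

(* Possibly unbounded operators; the values outside of the domain are junk. *)
Record operator := Operator { dom : set X; app :> X -> X }.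

Implicit Types (T : R -> X -> X) (A : operator) (z : R[i]).

(* Only the operators T t with t >= 0 are meaningful. *)
Record C0_semigroup T : Prop := C0Semigroup {
  semigroup_bounded : forall t : R, 0 <= t -> bounded_linear (T t);
  semigroup0 : forall x, T 0 x = x;
  semigroupD : forall s t : R, 0 <= s -> 0 <= t ->
    forall x, T (s + t) x = T s (T t x);
  semigroup_continuous : forall x, T t x @[t --> 0^'+] --> x }.

Definition difference_quotient T (x : X) (h : R) : X :=
  (h^-1)%:C *: (T h x - x).

Definition generator T : operator :=
  {| dom := [set x | cvg (difference_quotient T x h @[h --> 0^'+])];
     app := fun x => lim (difference_quotient T x h @[h --> 0^'+]) |}.

Definition opshift A z : operator :=
  {| dom := dom A; app := fun x => A x - z *: x |}.

Definition opker A : set X := [set x | dom A x /\ A x = 0].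

Definition oprange A : set X := [set A x | x in dom A].

Definition resolvent_set A : set R[i] :=
  [set z | exists S : X -> X, [/\ bounded_linear S,
     forall y, dom A (S y) /\ opshift A z (S y) = y &
     forall x, dom A x -> S (opshift A z x) = x]].

Definition spectrum A : set R[i] := ~` resolvent_set A.

(* Graph of the conjugate operator A' on the dual space X'; the regular module
   R[i]^o is the field of scalars seen as a normed space. *)
Definition conjugate A (phi psi : X -> R[i]^o) : Prop :=
  [/\ bounded_linear phi, bounded_linear psi &
      forall x, dom A x -> phi (A x) = psi x].

Definition conjugate_point_spectrum A : set R[i] :=
  [set z | exists phi : X -> R[i]^o, phi <> cst 0 /\
     conjugate A phi (fun x => z *: phi x)].

End Operators.

Definition imaginary_axis (R : realType) : set R[i] :=
  [set 0 +i* s | s in [set: R]].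

Arguments imaginary_axis : clear implicits.

(* Main.v *)
(* The seminorm [p x = limsup ||T t x|| / u t] is invariant under the semigroup because
   [u (t + s) / u t] tends to 1, so that [A] is dissipative in both directions:
   [|Re l| p x <= p (A x - l x)]. Let [N] be the resolvent of [A] at some point of the
   imaginary axis, and consider the pencil [1 - l N]: its singularities lie on the imaginary
   axis, and they are countably many. At an isolated singularity where the range is dense for
   [p], comparing the means of the resolvent over small and large circles, with weights that
   vanish at the imaginary axis to offset the bound [1 / |Re l|], shows that there is no
   singularity at all. As a countable closed set without isolated points is empty, the pencil
   is regular everywhere, and large circles give [p (N x) = 0] (Liouville), whence [p = 0].
   So if [p] is not zero, some [A - is] has a range which is not dense for [p]. Left half-plane
   resolvents exist only on the completion for [p]; instead of completing, equations are solved
   up to an arbitrarily small error. *)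
From HB Require Import structures.
Require Import Defs.
From mathcomp Require Import all_boot all_order all_algebra.
From mathcomp Require Import all_classical all_reals all_analysis.
From mathcomp Require Import ring lra.
Import Order.TTheory GRing.Theory Num.Theory.
Import numFieldNormedType.Exports.
Local Open Scope classical_set_scope.
Local Open Scope complex_scope.
Local Open Scope ring_scope.

Set Implicit Arguments.
Unset Strict Implicit.
Unset Printing Implicit Defensive.

(** * Seminorms and means over circles *)

(** There are no contour integrals: an integral over a circle becomes the mean over the powers of a
    root of unity close to 1, and Cauchy's theorem becomes an estimate drawn from a second-order
    Taylor bound, which the resolvent equation supplies even for approximate solutions. The pencil
    trades the unbounded [A] for a bounded operator: if [N] inverts [A - i s1], then
    [1 - l N = (A - i s1 - l) N], so that dissipativity and the singularities carry over, translated
    by [i s1]. Such a point exists because a countable set cannot fill the axis. The three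
    conditions give density of the ranges for [p] in different ways. Under (a), a vector at positive
    distance from the range of [A - is] would produce, by Hahn-Banach, an eigenvector of [A']. Under
    (b), it is enough that [p] is at most the norm. *)

Definition modulus (R : realType) (z : R[i]) : R := complex.Re `|z|.

Section Modulus.
Variable R : realType.
Implicit Types z w : R[i].

Lemma normr_modulus z : `|z| = (modulus z)%:C.
Proof. by rewrite /modulus normc_def. Qed.

Lemma modulus_ge0 z : 0 <= modulus z.
Proof. by rewrite -ler0c -normr_modulus. Qed.

Lemma modulusM z w : modulus (z * w) = modulus z * modulus w.
Proof. by apply: complexI; rewrite rmorphM /= -!normr_modulus normrM. Qed.

Lemma modulusD z w : modulus (z + w) <= modulus z + modulus w.
Proof. by rewrite -lecR rmorphD /= -!normr_modulus ler_normD. Qed.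

Lemma modulusN z : modulus (- z) = modulus z.
Proof. by rewrite /modulus normrN. Qed.

Lemma modulus1 : modulus (1 : R[i]) = 1.
Proof. by rewrite /modulus normr1. Qed.

Lemma modulusX z n : modulus (z ^+ n) = modulus z ^+ n.
Proof. by elim: n => [|n IH]; rewrite ?expr0 ?modulus1// !exprS modulusM IH. Qed.

Lemma modulusV z : modulus z^-1 = (modulus z)^-1.
Proof. by apply: complexI; rewrite fmorphV /= -!normr_modulus normfV. Qed.

Lemma modulus0 : modulus (0 : R[i]) = 0.
Proof. by rewrite /modulus normr0. Qed.

Lemma modulus_eq0 z : (modulus z == 0) = (z == 0).
Proof. by rewrite -(inj_eq (@complexI R)) -normr_modulus normr_eq0. Qed.

Lemma modulus_gt0 z : (0 < modulus z) = (z != 0).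
Proof. by rewrite lt0r modulus_ge0 andbT modulus_eq0. Qed.

Lemma modulus_real (x : R) : modulus x%:C = `|x|.
Proof. by rewrite /modulus normc_def /= expr0n /= addr0 sqrtr_sqr. Qed.

Lemma modulus_imag (x : R) : modulus (0 +i* x) = `|x|.
Proof. by rewrite /modulus normc_def /= expr0n /= add0r sqrtr_sqr. Qed.

Lemma modulus_Re z : `|complex.Re z| <= modulus z.
Proof.
rewrite /modulus normc_def /= -sqrtr_sqr ler_wsqrtr//.
by rewrite lerDl sqr_ge0.
Qed.

Lemma modulus_Im z : `|complex.Im z| <= modulus z.
Proof.
rewrite /modulus normc_def /= -sqrtr_sqr ler_wsqrtr//.
by rewrite lerDr sqr_ge0.
Qed.

Lemma Re_le_modulus z : complex.Re z <= modulus z.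
Proof. exact: le_trans (ler_norm _) (modulus_Re z). Qed.

Lemma modulus_le z : modulus z <= `|complex.Re z| + `|complex.Im z|.
Proof.
have -> : z = (complex.Re z)%:C + (0 +i* complex.Im z).
  by case: z => a b /=; simpc.
by apply: le_trans (modulusD _ _) _; rewrite modulus_real modulus_imag /= !(addr0, add0r).
Qed.

End Modulus.

Record seminorm (R : realType) (V : lmodType R[i]) (p : V -> R) : Prop :=
  Seminorm { seminormD : forall x y, p (x + y) <= p x + p y;
             seminormZ : forall a x, p (a *: x) = modulus a * p x }.

Section Seminorm.
Variables (R : realType) (V : lmodType R[i]) (p : V -> R) (hp : seminorm p).

Lemma seminorm0 : p 0 = 0.
Proof. by rewrite -(scale0r (0 : V)) (seminormZ hp) modulus0 mul0r. Qed.

Lemma seminormN x : p (- x) = p x.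
Proof. by rewrite -scaleN1r (seminormZ hp) modulusN modulus1 mul1r. Qed.

Lemma seminormB x y : p (x - y) <= p x + p y.
Proof. by rewrite -[p y]seminormN; exact: seminormD. Qed.

Lemma seminorm_distC x y : p (x - y) = p (y - x).
Proof. by rewrite -seminormN opprB. Qed.

Lemma seminorm_ge0 x : 0 <= p x.
Proof. by have := seminormB x x; rewrite subrr seminorm0; lra. Qed.

Lemma seminorm_leB x y : p x <= p (x - y) + p y.
Proof. by rewrite -{1}(subrK y x); exact: seminormD. Qed.

Lemma seminorm_sum n (F : nat -> V) (c : R) :
  (forall k, p (F k) <= c) -> p (\sum_(k < n) F k) <= n%:R * c.
Proof.
move=> Fc; elim: n => [|n IH]; first by rewrite big_ord0 seminorm0 mul0r.
rewrite big_ord_recr /= -natr1 mulrDl mul1r.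
by apply: le_trans (seminormD hp _ _) _; exact: lerD.
Qed.

End Seminorm.

Section CircleMean.
Variables (R : realType) (V : lmodType R[i]).

Definition circle_mean (n : nat) (zeta : R[i]) (f : R[i] -> V) (rho : R) : V :=
  n%:R^-1 *: \sum_(k < n) f (rho%:C * zeta ^+ k).

Lemma modulus_natV (n : nat) : modulus (n%:R^-1 : R[i]) = n%:R^-1.
Proof. by rewrite modulusV -(rmorph_nat (real_complex R)) modulus_real normr_nat. Qed.

Variables (p : V -> R) (hp : seminorm p).

Lemma circle_mean_le n zeta f rho c : (0 < n)%N ->
  (forall k : nat, p (f (rho%:C * zeta ^+ k)) <= c) -> p (circle_mean n zeta f rho) <= c.
Proof.
move=> n0 H; rewrite (seminormZ hp) modulus_natV ler_pdivrMl ?ltr0n//.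
exact: (seminorm_sum hp n (F := fun k => f (rho%:C * zeta ^+ k))).
Qed.

Variables (n : nat) (zeta : R[i]) (n_gt0 : (0 < n)%N).
Hypotheses (zeta_unit : modulus zeta = 1) (zetan : zeta ^+ n = 1) (zeta1 : zeta != 1).

Lemma modulus_circle rho k : 0 <= rho -> modulus (rho%:C * zeta ^+ k) = rho.
Proof.
by move=> r0; rewrite modulusM modulusX zeta_unit expr1n mulr1 modulus_real ger0_norm.
Qed.

Variables (f f' : R[i] -> V) (a b C e : R).
Hypotheses (a_gt0 : 0 < a) (C_ge0 : 0 <= C).
(* The slack [e] allows for approximate solutions of linear equations. *)
Hypothesis taylor : forall m h : R[i], a <= modulus m <= b -> a <= modulus (m + h) <= b ->
  p (f (m + h) - f m - h *: f' m) <= C * modulus h ^+ 2 + e.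

(* The tangential derivative has mean zero along the circle. *)
Lemma circle_mean_derive rho : a <= rho <= b ->
  p (circle_mean n zeta (fun m => m *: f' m) rho) <=
  C * rho ^+ 2 * modulus (zeta - 1) + e / modulus (zeta - 1).
Proof.
move=> /andP[ar rb]; have r0 : 0 < rho by exact: lt_le_trans ar.
have d0 : 0 < modulus (zeta - 1) by rewrite modulus_gt0 subr_eq0.
pose w k := rho%:C * zeta ^+ k.
have wS k : w k.+1 = w k + w k * (zeta - 1) by rewrite /w exprSr; ring.
have mw k : modulus (w k) = rho by rewrite modulus_circle// ltW.
have tele : \sum_(k < n) (f (w k.+1) - f (w k)) = 0.
  rewrite -(big_mkord xpredT (fun k => f (w k.+1) - f (w k))) telescope_sumr//.
  by rewrite /w zetan expr0 subrr.
(* Taylor along the chord [w k * (zeta - 1)]: the differences of [f] telescope to 0 around the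
   circle, so only the remainders [F k] are left. *)
pose F k := f (w k.+1) - f (w k) - (w k * (zeta - 1)) *: f' (w k).
have FE : (zeta - 1) *: \sum_(k < n) w k *: f' (w k) = - \sum_(k < n) F k.
  rewrite sumrB tele sub0r opprK scaler_sumr; apply: eq_bigr => k _.
  by rewrite scalerA mulrC.
have H : p (\sum_(k < n) F k) <= n%:R * (C * (rho * modulus (zeta - 1)) ^+ 2 + e).
  apply: (seminorm_sum hp n (F := F)) => k; rewrite /F wS.
  have := @taylor (w k) (w k * (zeta - 1)); rewrite -wS !mw ar rb => /(_ isT isT).
  by rewrite modulusM mw.
rewrite (seminormZ hp) modulus_natV ler_pdivrMl ?ltr0n//.
rewrite -(ler_pM2l d0) -(seminormZ hp) FE (seminormN hp) (le_trans H)//.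
by rewrite [leRHS]mulrCA ler_wpM2l// le_eqVlt; apply/orP; left; apply/eqP; field; rewrite gt_eqF.
Qed.

(** The radial derivative of [f] at [m = rho * zeta^k] is [zeta^k *: f' m], that is, [1 / rho] times
    [m *: f' m]. So the first-order part of the increment is [d / rho] times the mean bounded by
    [circle_mean_derive]. *)
Lemma circle_mean_step rho d : 0 <= d -> a <= rho -> rho + d <= b ->
  p (circle_mean n zeta f (rho + d) - circle_mean n zeta f rho) <=
  C * d ^+ 2 + e + d / a * (C * b ^+ 2 * modulus (zeta - 1) + e / modulus (zeta - 1)).
Proof.
move=> d0 ar rb; have r0 : 0 < rho by exact: lt_le_trans ar.
have rb' : rho <= b by lra.
have z0 : 0 < modulus (zeta - 1) by rewrite modulus_gt0 subr_eq0.
pose w k := rho%:C * zeta ^+ k.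
pose F k := f (w k + d%:C * zeta ^+ k) - f (w k) - (d%:C * zeta ^+ k) *: f' (w k).
have -> : circle_mean n zeta f (rho + d) - circle_mean n zeta f rho =
    n%:R^-1 *: (\sum_(k < n) F k) + (d / rho)%:C *: circle_mean n zeta (fun m => m *: f' m) rho.
  rewrite /circle_mean -scalerBr -sumrB scalerA [(d / rho)%:C * _]mulrC -scalerA.
  rewrite -scalerDr [(d / rho)%:C *: _]scaler_sumr -big_split /=; congr (_ *: _); apply: eq_bigr => k _.
  rewrite /F /w rmorphD mulrDl scalerA.
  suff -> : (d / rho)%:C * (rho%:C * zeta ^+ k) = d%:C * zeta ^+ k by rewrite subrK.
  by rewrite mulrA -rmorphM /= divfK ?gt_eqF.
apply: le_trans (seminormD hp _ _) _; apply: lerD.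
  rewrite (seminormZ hp) modulus_natV ler_pdivrMl ?ltr0n//.
  apply: (seminorm_sum hp n (F := F)) => k; rewrite /F.
  have := @taylor (w k) (d%:C * zeta ^+ k); rewrite {2}/w -mulrDl -rmorphD !modulus_circle ?ar ?rb'//; last 2 first.
  - exact: addr_ge0 (ltW r0) d0.
  - exact: ltW.
  move=> /(_ isT) -> //.
  by rewrite rb andbT; lra.
rewrite (seminormZ hp) modulus_real ger0_norm ?divr_ge0 ?(ltW r0)//.
apply: ler_pM; rewrite ?divr_ge0 ?(ltW r0) ?(seminorm_ge0 hp)//.
  by rewrite ler_wpM2l// lef_pV2.
apply: le_trans (circle_mean_derive _) _; first by rewrite ar.
rewrite lerD2r ler_wpM2r ?(ltW z0)// ler_wpM2l// ler_pXn2r ?nnegrE ?(ltW r0)//.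
by rewrite (le_trans _ rb')// ltW.
Qed.

(** A discrete Cauchy theorem. Over [J] radial steps the quadratic errors add up to only
    [C * (b - a)^2 / J], whereas the slack [e] is multiplied by [J]. *)
Lemma circle_mean_diff J : (0 < J)%N -> a <= b ->
  p (circle_mean n zeta f b - circle_mean n zeta f a) <=
  C * (b - a) ^+ 2 / J%:R + J%:R * e +
  (b - a) / a * (C * b ^+ 2 * modulus (zeta - 1) + e / modulus (zeta - 1)).
Proof.
move=> J0 ab; pose d := (b - a) / J%:R.
have JR : 0 < J%:R :> R by rewrite ltr0n.
have d0 : 0 <= d by rewrite divr_ge0 ?subr_ge0// ltW.
pose K := C * d ^+ 2 + e + d / a * (C * b ^+ 2 * modulus (zeta - 1) + e / modulus (zeta - 1)).
have H j : (j <= J)%N -> p (circle_mean n zeta f (a + j%:R * d) - circle_mean n zeta f a) <= j%:R * K.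
  elim: j => [|j IH] jJ; first by rewrite !mul0r addr0 subrr (seminorm0 hp).
  rewrite -natr1 !mulrDl !mul1r addrA.
  rewrite -(subrKA (circle_mean n zeta f (a + j%:R * d))) addrC.
  rewrite [leRHS]addrC addrC.
  apply: le_trans (seminormD hp _ _) _; apply: lerD; last by apply: IH; exact: ltnW.
  apply: circle_mean_step => //; first by rewrite lerDl mulr_ge0.
  rewrite -addrA -{2}(mul1r d) -mulrDl natr1 -lerBrDl.
  by rewrite -[leRHS](@divfK _ J%:R) ?gt_eqF// mulrC ler_wpM2l// ler_nat.
have := H J (leqnn J).
have -> : a + J%:R * d = b by rewrite /d; field; rewrite gt_eqF.
move=> /le_trans; apply; rewrite le_eqVlt; apply/orP; left; apply/eqP.
rewrite /K /d; set z := modulus _.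
by field; rewrite !gt_eqF// modulus_gt0 subr_eq0.
Qed.

End CircleMean.

(** * Roots of unity close to 1 *)

Section Cis.
Variable R : realType.

Definition cis (t : R) : R[i] := cos t +i* sin t.

Lemma cis0 : cis 0 = 1.
Proof. by rewrite /cis cos0 sin0. Qed.

Lemma cisD s t : cis (s + t) = cis s * cis t.
Proof. by rewrite /cis cosD sinD; simpc; congr (_ +i* _); ring. Qed.

Lemma cis_natmul t n : cis (n%:R * t) = cis t ^+ n.
Proof.
elim: n => [|n IH]; first by rewrite mul0r cis0 expr0.
by rewrite -natr1 mulrDl mul1r cisD IH exprSr.
Qed.

Lemma modulus_cis t : modulus (cis t) = 1.
Proof. by rewrite /modulus normc_def /= cos2Dsin2 sqrtr1. Qed.

Lemma cis_near1 (eta : R) : 0 < eta ->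
  exists2 d : R, 0 < d & forall t, `|t| < d -> modulus (cis t - 1) <= eta.
Proof.
move=> eta0; have e2 : 0 < eta / 2 by rewrite divr_gt0.
have := @continuous_cos R 0; rewrite /continuous_at cos0.
move=> /cvgrPdist_lt /(_ _ e2) /nbhs_ballP[d1 /= d10 H1].
have := @continuous_sin R 0; rewrite /continuous_at sin0.
move=> /cvgrPdist_lt /(_ _ e2) /nbhs_ballP[d2 /= d20 H2].
exists (Num.min d1 d2); first by rewrite lt_min d10.
move=> t; rewrite lt_min => /andP[t1 t2].
apply: le_trans (modulus_le _) _ => /=.
have /= := H1 t; rewrite /ball /= sub0r normrN distrC => /(_ t1) h1.
have /= := H2 t; rewrite /ball /= !sub0r !normrN => /(_ t2) h2.
by rewrite oppr0 addr0 [eta]splitr; apply: lerD; exact: ltW.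
Qed.

(** The condition [zeta ^+ 2 != 1] makes the even powers of [zeta] have mean zero, as the weighted
    means require. *)
Lemma root_of_unity_near1 (eta : R) : 0 < eta -> exists n (zeta : R[i]),
  [/\ (0 < n)%N, modulus zeta = 1, zeta ^+ n = 1, zeta ^+ 2 != 1 & modulus (zeta - 1) <= eta].
Proof.
move=> eta0.
have m0 : 0 < Num.min eta 1 by rewrite lt_min eta0 ltr01.
have [d d0 H] := cis_near1 m0.
have p0 : 0 < pi *+ 2 :> R by rewrite mulrn_wgt0// pi_gt0.
(* At least 3, so that the angle lies strictly between 0 and pi and the sine is positive. *)
pose n := (Num.truncn (pi *+ 2 / d)).+3.
have n0 : 0 < n%:R :> R by rewrite ltr0n.
have nd : pi *+ 2 / d < n%:R.
  apply: lt_le_trans (truncnS_gt _) _.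
  by rewrite ler_nat /n ltnS leqW.
exists n, (cis (pi *+ 2 / n%:R)).
have dist : modulus (cis (pi *+ 2 / n%:R) - 1) <= Num.min eta 1.
  by apply: H; rewrite gtr0_norm ?divr_gt0// ltr_pdivrMr// mulrC -ltr_pdivrMr.
have s0 : 0 < sin (pi *+ 2 / n%:R : R).
  apply: sin_gt0_pi; rewrite divr_gt0//= ltr_pdivrMr//.
  rewrite -[pi *+ 2]mulr_natr ltr_pM2l ?pi_gt0// ltr_nat.
  by rewrite /n.
split => //.
- exact: modulus_cis.
- by rewrite -cis_natmul mulrC divfK ?gt_eqF// /cis cos2pi sin2pi.
- rewrite -subr_eq0 subr_sqr_1 mulf_eq0 negb_or; apply/andP; split.
    by apply/eqP => /(congr1 (@complex.Im R)) /= /eqP; rewrite subr0 gt_eqF.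
  apply/eqP => /(congr1 (@complex.Im R)) /= /eqP; rewrite addr0 gt_eqF//.
- by move: dist; rewrite le_min => /andP[].
Qed.

End Cis.

(** The slack [e] is fixed last, since its coefficient grows with [J] and with
    [1 / modulus (zeta - 1)]. Nothing depends on [f], so the approximate solutions can be taken
    after [e] is known. *)
Lemma circle_mean_close (R : realType) (a b C eta : R) :
  0 < a -> a <= b -> 0 <= C -> 0 < eta -> exists n (zeta : R[i]) (e : R),
  [/\ (0 < n)%N, modulus zeta = 1, zeta ^+ 2 != 1, zeta ^+ n = 1 & 0 < e] /\
  forall (V : lmodType R[i]) (p : V -> R) (hp : seminorm p) (f f' : R[i] -> V),
  (forall m h : R[i], a <= modulus m <= b -> a <= modulus (m + h) <= b ->
     p (f (m + h) - f m - h *: f' m) <= C * modulus h ^+ 2 + e) ->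
  p (circle_mean n zeta f b - circle_mean n zeta f a) <= eta.
Proof.
move=> a0 ab C0 eta0.
have b0 : 0 < b by exact: lt_le_trans ab.
have q0 : 0 <= (b - a) / a by rewrite divr_ge0 ?subr_ge0// ltW.
have K0 : 0 <= (b - a) / a * (C * b ^+ 2) by rewrite mulr_ge0// mulr_ge0// exprn_ge0// ltW.
set K := (b - a) / a * (C * b ^+ 2) in K0.
have K1 : 0 < K + 1 by rewrite ltr_wpDl.
have [n [zeta [n0 zu zn z2 zd]]] : exists n (zeta : R[i]),
  [/\ (0 < n)%N, modulus zeta = 1, zeta ^+ n = 1, zeta ^+ 2 != 1 &
    modulus (zeta - 1) <= eta / 4 / (K + 1)].
  by apply: root_of_unity_near1; rewrite !divr_gt0.
have z1 : zeta != 1 by apply: contra_neq z2 => ->; rewrite expr1n.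
have d0 : 0 < modulus (zeta - 1) by rewrite modulus_gt0 subr_eq0.
set d := modulus (zeta - 1) in d0 zd.
pose J := (Num.truncn (C * (b - a) ^+ 2 / (eta / 4))).+1.
have J0 : 0 < J%:R :> R by rewrite ltr0n.
have HJ : C * (b - a) ^+ 2 / J%:R <= eta / 4.
  by rewrite ler_pdivrMr// [leRHS]mulrC -ler_pdivrMr ?divr_gt0//; by rewrite ltW// truncnS_gt.
have Kd : K * d <= eta / 4.
  apply: le_trans (_ : (K + 1) * d <= _); first by rewrite ler_wpM2r ?lerDl// ltW.
  by rewrite mulrC -ler_pdivlMr.
(* The total coefficient of the slack in [circle_mean_diff]. *)
pose L := J%:R + (b - a) / a / d.
have L0 : 0 < L by rewrite ltr_pwDl// divr_ge0// ltW.
have e0 : 0 < eta / 4 / L by rewrite !divr_gt0.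
exists n, zeta, (eta / 4 / L); split; first by split.
move=> V p hp f f' H.
have J1 : (0 < J)%N by [].
have := circle_mean_diff hp n0 zu zn z1 a0 C0 H J1 ab.
move=> /le_trans; apply.
rewrite -/d.
have -> : C * (b - a) ^+ 2 / J%:R + J%:R * (eta / 4 / L) +
    (b - a) / a * (C * b ^+ 2 * d + eta / 4 / L / d) =
  C * (b - a) ^+ 2 / J%:R + K * d + L * (eta / 4 / L).
  by set E := eta / 4 / L; rewrite /L /K; ring.
rewrite [L * _]mulrC divfK ?gt_eqF//.
lra.
Qed.

(** * Pencils of a bounded operator *)

Section Pencil.
Variables (R : realType) (V : lmodType R[i]) (p : V -> R) (hp : seminorm p).
Variable N : {linear V -> V}.

Definition pencil (l : R[i]) (y : V) : V := y - l *: N y.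

Lemma pencilD l x y : pencil l (x + y) = pencil l x + pencil l y.
Proof. by rewrite /pencil linearD scalerDr opprD addrACA. Qed.

Lemma pencilZ l a x : pencil l (a *: x) = a *: pencil l x.
Proof. by rewrite /pencil [N (a *: x)]linearZ /= scalerBr !scalerA mulrC. Qed.

Lemma pencilB l x y : pencil l (x - y) = pencil l x - pencil l y.
Proof. by rewrite -scaleN1r pencilD pencilZ scaleN1r. Qed.

Lemma pencil_shift k l y : pencil k y = pencil l y - (k - l) *: N y.
Proof. by rewrite /pencil scalerBl opprB subrKA. Qed.

(** Together with [dense_range], this expresses that the pencil is invertible on the completion for
    [p], with an inverse of norm at most [c]. *)
Definition bounded_below (c : R) (l : R[i]) := forall y, p y <= c * p (pencil l y).

Definition dense_range (l : R[i]) :=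
  forall x e, 0 < e -> exists y, p (pencil l y - x) <= e.

Lemma bounded_belowW c d l : c <= d -> bounded_below c l -> bounded_below d l.
Proof.
move=> cd H y; apply: le_trans (H y) _.
by rewrite ler_wpM2r// (seminorm_ge0 hp).
Qed.

Variables (M : R) (M_gt0 : 0 < M) (NM : forall x, p (N x) <= M * p x).

Lemma bounded_below_near c l k : 0 < c -> modulus (k - l) * (c * M) <= 2^-1 ->
  bounded_below c l -> bounded_below (2 * c) k.
Proof.
move=> c0 kl H y; have := H y; rewrite (pencil_shift l k).
set P := pencil k y => h; have py := seminorm_ge0 hp y.
have : p (P - (l - k) *: N y) <= p P + modulus (k - l) * (M * p y).
  apply: le_trans (seminormB hp _ _) _; rewrite lerD2l (seminormZ hp).
  by rewrite -modulusN opprB ler_wpM2l ?modulus_ge0.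
rewrite -(ler_pM2l c0) => h2.
have h3 : modulus (k - l) * (c * M) * p y <= 2^-1 * p y by exact: ler_wpM2r.
nra.
Qed.

(* Successive approximation: each step shrinks the residual by the factor 3/4. *)
Lemma dense_range_near c l k : 0 < c -> modulus (k - l) * (c * M) <= 2^-1 ->
  bounded_below c l -> dense_range l -> dense_range k.
Proof.
move=> c0 kl bl dl.
have step x : exists y, p (pencil k y - x) <= 3 / 4 * p x.
  have := seminorm_ge0 hp x; rewrite le_eqVlt => /predU1P[x0|x0].
    exists 0; rewrite -(scale0r 0) pencilZ !scale0r sub0r (seminormN hp) -x0 mulr0//.
  (* The new residual is at most [1/6 + 1/2 * 7/6 = 3/4] of [p x]. *)
  have [y hy] := dl x (p x / 6) (divr_gt0 x0 (ltr0Sn _ _)).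
  exists y; rewrite (pencil_shift k l) addrAC.
  have h1 : p y <= c * (p x + p x / 6).
    apply: le_trans (bl y) _; rewrite ler_wpM2l ?(ltW c0)//.
    by apply: le_trans (seminorm_leB hp _ x) _; rewrite addrC lerD2l.
  apply: le_trans (seminormB hp _ _) _; rewrite (seminormZ hp).
  have h2 : modulus (k - l) * p (N y) <= modulus (k - l) * (M * p y).
    by rewrite ler_wpM2l ?modulus_ge0.
  have h3 : modulus (k - l) * M * p y <= modulus (k - l) * M * (c * (p x + p x / 6)).
    by rewrite ler_wpM2l// mulr_ge0 ?modulus_ge0// ltW.
  have h4 : modulus (k - l) * (c * M) * (p x + p x / 6) <= 2^-1 * (p x + p x / 6).
    by rewrite ler_wpM2r// addr_ge0 ?divr_ge0// ltW.
  nra.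
have iter x n : exists y, p (pencil k y - x) <= (3 / 4) ^+ n * p x.
  elim: n => [|n [y hy]].
    exists 0; rewrite -(scale0r 0) pencilZ !scale0r sub0r (seminormN hp) expr0 mul1r//.
  have [z hz] := step (x - pencil k y).
  exists (y + z); rewrite pencilD exprS -mulrA.
  have -> : pencil k y + pencil k z - x = pencil k z - (x - pencil k y).
    by move: (pencil k y) (pencil k z) => P Q; rewrite opprB addrCA addrA.
  apply: le_trans hz _; rewrite ler_wpM2l//.
  by rewrite (seminorm_distC hp).
move=> x e e0.
have [x0|x0] := eqVneq (p x) 0.
  by have [y hy] := iter x 0%N; exists y; rewrite (le_trans hy)// x0 mulr0 ltW.
have px : 0 < p x by rewrite lt0r x0 seminorm_ge0.
have : (3 / 4 : R) ^+ n @[n --> \oo] --> 0.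
  by apply: cvg_expr; rewrite ger0_norm; lra.
move=> /cvgrPdist_lt /(_ (e / p x) (divr_gt0 e0 px)) [n _ /(_ n (leqnn n))] /=.
rewrite sub0r normrN ger0_norm ?exprn_ge0// => hn.
have [y hy] := iter x n; exists y; apply: le_trans hy _.
by rewrite -ler_pdivlMr// ltW.
Qed.

Hypothesis dissipative : forall l y, `|complex.Re l| * p (N y) <= p (pencil l y).

Lemma bounded_below_Re l : complex.Re l != 0 ->
  bounded_below (1 + modulus l / `|complex.Re l|) l.
Proof.
move=> l0 y; have r0 : 0 < `|complex.Re l| by rewrite normr_gt0.
have : p y <= p (pencil l y) + modulus l * p (N y).
  rewrite -(seminormZ hp) -{1}(subrK (l *: N y) y); exact: seminormD.
move=> /le_trans; apply.
rewrite mulrDl mul1r lerD2l -mulrA ler_wpM2l ?modulus_ge0//.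
by rewrite mulrC ler_pdivlMr// mulrC.
Qed.

(** Continuity method along the segment from 0, where the pencil is the identity, to [l]. The
    quotient [|l| / |Re l|] is constant on the ray, so one constant [c] serves all the points and
    finitely many equal steps suffice. *)
Lemma dense_range_Re l : complex.Re l != 0 -> dense_range l.
Proof.
move=> l0; pose c := 1 + modulus l / `|complex.Re l|.
have c1 : 1 <= c by rewrite lerDl divr_ge0 ?modulus_ge0.
have c0 : 0 < c by exact: lt_le_trans c1.
pose K := modulus l * (c * M) * 2.
pose n := (Num.truncn K).+1.
have n0 : 0 < n%:R :> R by rewrite ltr0n.
pose t (j : nat) := (j%:R / n%:R : R)%:C * l.
have bt j : bounded_below c (t j).
  case: j => [|j].
    move=> y; rewrite /t mul0r /= mul0r /pencil scale0r subr0.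
    by rewrite ler_peMl// (seminorm_ge0 hp).
  have jn : 0 < (j.+1%:R / n%:R : R) by rewrite divr_gt0// ltr0n.
  have Ret : complex.Re (t j.+1) = j.+1%:R / n%:R * complex.Re l.
    by rewrite /t; case: (l) => a b /=; ring.
  have := @bounded_below_Re (t j.+1); rewrite Ret mulf_neq0// ?gt_eqF// => /(_ isT).
  rewrite /c /t modulusM modulus_real !normrM -!(normrM j.+1%:R) (gtr0_norm jn).
  by rewrite -mulf_div divff ?mul1r// gt_eqF.
have st j : modulus (t j.+1 - t j) * (c * M) <= 2^-1.
  have -> : t j.+1 - t j = (n%:R^-1)%:C * l.
    by rewrite /t -mulrBl -rmorphB -mulrBl -natr1 addrAC subrr add0r mul1r.
  rewrite modulusM modulus_real ger0_norm ?invr_ge0 ?ler0n// -mulrA.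
  rewrite mulrC ler_pdivrMr// -ler_pdivrMl ?invrK ?invr_gt0//.
  by rewrite mulrC ltW// truncnS_gt.
have dt j : dense_range (t j).
  elim: j => [|j IH]; last exact: dense_range_near c0 (st j) (bt j) IH.
  move=> x e e0; exists x; rewrite /t mul0r /= mul0r /pencil scale0r subr0 subrr (seminorm0 hp).
  exact: ltW.
by have := dt n; rewrite /t divff ?gt_eqF//= mul1r.
Qed.

(** Compactness: a bound [c] at one point gives [2 * c] in a neighbourhood. The uniform constant is
    found by letting the bound run along the filter at infinity in the near-covering form of
    compactness. *)
Lemma bounded_below_segment (a b : R) :
  (forall s, a <= s <= b -> exists c, bounded_below c (0 +i* s)) ->
  exists2 c, 0 < c & forall s, a <= s <= b -> bounded_below c (0 +i* s).
Proof.
move=> H.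
have /compact_near_coveringP := @segment_compact R a b.
move=> /(_ R +oo%R (fun c s => bounded_below c (0 +i* s)) _) [].
  move=> s /=; rewrite in_itv /= => /H[c hc].
  pose c1 := Num.max c 1.
  have c0 : 0 < c1 by rewrite lt_max ltr01 orbT.
  have hc1 : bounded_below c1 (0 +i* s) by apply: bounded_belowW hc; rewrite le_max lexx.
  have d0 : 0 < 2^-1 / (c1 * M) by rewrite divr_gt0// mulr_gt0.
  exists (ball s (2^-1 / (c1 * M)), [set x | 2 * c1 < x]).
    split; first exact: nbhsx_ballx.
    by exists (2 * c1); split => //; rewrite num_real.
  move=> [s' c'] [/= ss' cc'].
  apply: (bounded_belowW (ltW cc')); apply: (bounded_below_near c0 _ hc1).
  have -> : (0 +i* s') - (0 +i* s) = 0 +i* (s' - s) by simpc.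
  have cM : 0 < c1 * M by exact: mulr_gt0.
  by rewrite modulus_imag distrC -ler_pdivlMr// ltW.
move=> c0 [_ hc]; exists (Num.max c0 0 + 1); first by rewrite ltr_wpDl// le_max lexx orbT.
move=> s sab; apply: hc; last by rewrite /= in_itv.
by rewrite ltr_pwDr// le_max lexx.
Qed.

(** Close to the imaginary axis the bound is a perturbation of those on two compact segments, one on
    each side of the centre; away from the axis it is [bounded_below_Re]. *)
Lemma bounded_below_annulus (s0 a r : R) : 0 < a ->
  (forall s, 0 < `|s| <= r -> exists c, bounded_below c (0 +i* (s0 + s))) ->
  exists2 c, 0 < c & forall m, a <= modulus m <= r -> bounded_below c ((0 +i* s0) + m).
Proof.
move=> a0 H.
have a2 : 0 < a / 2 by rewrite divr_gt0.
have [c1 c10 H1] : exists2 c, 0 < c &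
    forall s, s0 + a / 2 <= s <= s0 + r -> bounded_below c (0 +i* s).
  apply: bounded_below_segment => s hs.
  have := H (s - s0); rewrite subrKC; apply.
  by rewrite gtr0_norm; lra.
have [c2 c20 H2] : exists2 c, 0 < c &
    forall s, s0 - r <= s <= s0 - a / 2 -> bounded_below c (0 +i* s).
  apply: bounded_below_segment => s hs.
  have := H (s - s0); rewrite subrKC; apply.
  by rewrite ltr0_norm; lra.
pose c := Num.max c1 c2.
have c0 : 0 < c by rewrite lt_max c10.
have H3 s : a / 2 <= `|s| <= r -> bounded_below c (0 +i* (s0 + s)).
  case: (ger0P s) => s0'.
    by move=> ?; apply: bounded_belowW (H1 _ _); rewrite ?le_max ?lexx//; lra.
  by move=> ?; apply: bounded_belowW (H2 _ _); rewrite ?le_max ?lexx ?orbT//; lra.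
(* With [|Re m| <= a / 2], a point of the annulus has [|Im m| >= a / 2], hence projects into one of
   the segments; the other term is the radius allowed by [bounded_below_near]. *)
pose d := Num.min (a / 2) (2^-1 / (c * M)).
have d0 : 0 < d by rewrite lt_min a2 divr_gt0 ?mulr_gt0.
pose L := 1 + (`|s0| + Num.max r 0) / d.
have L0 : 0 < L by rewrite ltr_pwDl// divr_ge0 ?(ltW d0)// addr_ge0// le_max lexx orbT.
exists (Num.max (2 * c) L); first by rewrite lt_max L0 orbT.
move=> m /andP[am mr].
have [md|md] := lerP `|complex.Re m| d.
  apply: bounded_belowW (_ : 2 * c <= _) _; first by rewrite le_max lexx.
  apply: (@bounded_below_near c (0 +i* (s0 + complex.Im m))) => //.
    have -> : (0 +i* s0) + m - (0 +i* (s0 + complex.Im m)) = (complex.Re m)%:C.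
      by case: (m) => x y; simpc; congr (_ +i* _); ring.
    rewrite modulus_real -ler_pdivlMr ?mulr_gt0//.
    by apply: le_trans md _; rewrite /d ge_min lexx orbT.
  apply: H3; apply/andP; split; last exact: le_trans (modulus_Im m) mr.
  have := modulus_le m; have : d <= a / 2 by rewrite /d ge_min lexx.
  by move: md am; lra.
have mRe : complex.Re ((0 +i* s0) + m) = complex.Re m by case: (m) => x y; simpc.
have m0 : complex.Re ((0 +i* s0) + m) != 0.
  by rewrite mRe -normr_gt0 (lt_trans d0).
apply: bounded_belowW (bounded_below_Re m0).
rewrite le_max; apply/orP; right; rewrite lerD2l mRe.
apply: ler_pM; rewrite ?modulus_ge0 ?invr_ge0//.
  apply: le_trans (modulusD _ _) _; rewrite modulus_imag lerD2l.
  by rewrite le_max mr.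
by rewrite lef_pV2 ?posrE ?(lt_trans d0 md)// ltW.
Qed.

End Pencil.

(** * A weight vanishing with the real part on two concentric circles *)

Section CircleWeight.
Variables (R : realType) (a r : R).
Hypotheses (a_gt0 : 0 < a) (a_le_r : a <= r).
Implicit Types m h : R[i].

(* On the circles of radii [a] and [r] it vanishes like the real part. *)
Definition circle_weight m : R[i] := (1 + (a%:C / m) ^+ 2) * (1 + (m / r%:C) ^+ 2).

(** The complex derivative, read off the expansion [1 + (a/r)^2 + (a/m)^2 + (m/r)^2] of the
    weight. *)
Definition circle_weight' m : R[i] := - 2 * a%:C ^+ 2 / m ^+ 3 + 2 * m / r%:C ^+ 2.

Let r_gt0 : 0 < r. Proof. exact: lt_le_trans a_le_r. Qed.
Let rC0 : r%:C != 0. Proof. by rewrite -modulus_gt0 modulus_real gtr0_norm. Qed.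

Let annulus_neq0 m : a <= modulus m -> m != 0.
Proof. by move=> am; rewrite -modulus_gt0 (lt_le_trans a_gt0). Qed.

(** This is [m * (m + conj m)], because [rho^2 = m * conj m]. *)
Lemma sqr_addr_circle rho m : modulus m = rho ->
  m ^+ 2 + rho%:C ^+ 2 = 2 * (complex.Re m)%:C * m.
Proof.
case: m => x y <-; rewrite /modulus normc_def /= -rmorphXn /= sqr_sqrtr ?addr_ge0 ?sqr_ge0//.
by simpc; congr (_ +i* _); ring.
Qed.

Let modulus_factor_le2 (z : R[i]) : modulus z <= 1 -> modulus (1 + z ^+ 2) <= 2.
Proof.
move=> z1; apply: le_trans (modulusD _ _) _; rewrite modulus1 modulusX.
by have := modulus_ge0 z; nra.
Qed.

Let inner_ratio m : a <= modulus m -> modulus (a%:C / m) <= 1.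
Proof.
move=> am; rewrite modulusM modulusV modulus_real gtr0_norm//.
by rewrite ler_pdivrMr ?mul1r// (lt_le_trans a_gt0).
Qed.

Let outer_ratio m : modulus m <= r -> modulus (m / r%:C) <= 1.
Proof.
by move=> mr; rewrite modulusM modulusV modulus_real gtr0_norm// ler_pdivrMr// mul1r.
Qed.

Lemma circle_weight_le4 m : a <= modulus m <= r -> modulus (circle_weight m) <= 4.
Proof.
move=> /andP[am mr]; rewrite modulusM (_ : 4 = 2 * 2); last by ring.
by apply: ler_pM; rewrite ?modulus_ge0 ?modulus_factor_le2 ?inner_ratio ?outer_ratio.
Qed.

Lemma circle_weight_outer m : modulus m = r ->
  modulus (circle_weight m) <= 4 / r * `|complex.Re m|.
Proof.
move=> mr; have m0 : m != 0 by rewrite annulus_neq0 ?mr.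
have -> : circle_weight m =
    (1 + (a%:C / m) ^+ 2) * (2 * (complex.Re m)%:C * m / r%:C ^+ 2).
  by rewrite -(sqr_addr_circle mr) /circle_weight; field; rewrite rC0 m0.
rewrite modulusM.
have -> : 4 / r * `|complex.Re m| = 2 * (2 * `|complex.Re m| * r / r ^+ 2).
  by field; rewrite gt_eqF.
apply: ler_pM; rewrite ?modulus_ge0//.
  by rewrite modulus_factor_le2// inner_ratio// mr.
rewrite !modulusM modulusV modulusX !modulus_real mr (gtr0_norm r_gt0).
by rewrite -(rmorph_nat (real_complex R)) modulus_real normr_nat.
Qed.

Lemma circle_weight_inner m : modulus m = a ->
  modulus (circle_weight m) <= 4 / a * `|complex.Re m|.
Proof.
move=> ma; have m0 : m != 0 by rewrite annulus_neq0 ?ma.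
have -> : circle_weight m =
    (1 + (m / r%:C) ^+ 2) * (2 * (complex.Re m)%:C * m / m ^+ 2).
  by rewrite -(sqr_addr_circle ma) /circle_weight; field; rewrite rC0 m0.
rewrite modulusM.
have -> : 4 / a * `|complex.Re m| = 2 * (2 * `|complex.Re m| * a / a ^+ 2).
  by field; rewrite gt_eqF.
apply: ler_pM; rewrite ?modulus_ge0//.
  by rewrite modulus_factor_le2// outer_ratio// ma.
rewrite !modulusM modulusV modulusX !modulus_real ma.
by rewrite -(rmorph_nat (real_complex R)) modulus_real normr_nat.
Qed.

Let modulus2 : modulus (2 : R[i]) = 2.
Proof. by rewrite -(rmorph_nat (real_complex R)) modulus_real normr_nat. Qed.

Lemma circle_weight'_le m : a <= modulus m <= r ->
  modulus (circle_weight' m) <= 2 / a + 2 / r.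
Proof.
move=> /andP[am mr]; apply: le_trans (modulusD _ _) _; apply: lerD.
  rewrite !mulNr modulusN !modulusM modulusV !modulusX modulus_real modulus2 gtr0_norm//.
  rewrite (_ : 2 / a = 2 * a ^+ 2 * (a ^+ 3)^-1); last by field; rewrite gt_eqF.
  rewrite ler_wpM2l ?mulr_ge0 ?(ltW a_gt0)// lef_pV2 ?posrE ?exprn_gt0//; last exact: lt_le_trans am.
  by rewrite ler_pXn2r// nnegrE ?modulus_ge0// ltW.
rewrite !modulusM modulusV !modulusX modulus_real modulus2 (gtr0_norm r_gt0).
rewrite (_ : 2 / r = 2 * r / r ^+ 2); last by field; rewrite gt_eqF.
by rewrite ler_wpM2r ?invr_ge0 ?sqr_ge0// ler_wpM2l.
Qed.

(** With [k = m + h], the second-order remainder is exactly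
    [(a^2 (m + 2k) / (m^3 k^2) + 1 / r^2) h^2]; on the annulus [|m + 2k| <= 3r] and
    [|m^3 k^2| >= a^5]. *)
Definition circle_weight_taylor_cst : R := a ^+ 2 * (3 * r) / (a ^+ 5) + (r ^+ 2)^-1.

Lemma circle_weight_taylor m h : a <= modulus m <= r -> a <= modulus (m + h) <= r ->
  modulus (circle_weight (m + h) - circle_weight m - h * circle_weight' m) <=
  circle_weight_taylor_cst * modulus h ^+ 2.
Proof.
move=> /andP[am mr] /andP[ak kr]; set k := m + h.
have m0 := annulus_neq0 am; have k0 : k != 0 := annulus_neq0 ak.
have -> : circle_weight k - circle_weight m - h * circle_weight' m =
    (a%:C ^+ 2 * (m + 2 * k) / (m ^+ 3 * k ^+ 2) + (r%:C ^+ 2)^-1) * h ^+ 2.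
  have -> : h = k - m by rewrite /k; ring.
  rewrite /circle_weight /circle_weight'; field.
  by rewrite rC0 m0 k0.
rewrite modulusM modulusX ler_wpM2r ?sqr_ge0//.
apply: le_trans (modulusD _ _) _; rewrite modulusV !modulusM modulusV modulusM !modulusX.
rewrite !modulus_real (gtr0_norm a_gt0) (gtr0_norm r_gt0) lerD2r.
apply: ler_pM; rewrite ?mulr_ge0 ?invr_ge0 ?mulr_ge0 ?exprn_ge0 ?modulus_ge0// ?(ltW a_gt0)//.
  rewrite ler_wpM2l ?sqr_ge0//; apply: le_trans (modulusD _ _) _; rewrite modulusM modulus2.
  by move: mr kr; rewrite -/k; lra.
have mp := lt_le_trans a_gt0 am; have kp := lt_le_trans a_gt0 ak.
rewrite lef_pV2 ?posrE ?mulr_gt0 ?exprn_gt0// (_ : 5 = 3 + 2)%N// exprD.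
by apply: ler_pM; rewrite ?exprn_ge0 ?(ltW a_gt0)// ler_pXn2r// nnegrE ltW.
Qed.

Lemma sum_root_of_unity n (w : R[i]) : w != 1 -> w ^+ n = 1 -> \sum_(k < n) w ^+ k = 0.
Proof.
move=> w1 wn; have := subrX1 w n; rewrite wn subrr => /esym/eqP.
by rewrite mulf_eq0 subr_eq0 (negbTE w1) /= => /eqP.
Qed.

(** Only the constant term of the Laurent polynomial survives: the other two are multiples of even
    powers of [zeta], whose sums are geometric and vanish. *)
Lemma circle_mean_weight (V : lmodType R[i]) n zeta (y : V) :
  (0 < n)%N -> zeta ^+ 2 != 1 -> zeta ^+ n = 1 ->
  circle_mean n zeta (fun m => circle_weight m *: y) a = (1 + (a / r) ^+ 2)%:C *: y.
Proof.
move=> n0 z2 zn.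
have aC0 : a%:C != 0 by rewrite -modulus_gt0 modulus_real gtr0_norm.
have z0 : zeta != 0.
  by apply: contra_eq_neq zn => ->; rewrite expr0n gtn_eqF// eq_sym oner_eq0.
rewrite /circle_mean -scaler_suml scalerA; congr (_ *: _).
have -> : \sum_(i < n) circle_weight (a%:C * zeta ^+ i) =
   \sum_(i < n) ((1 + (a / r) ^+ 2)%:C + (zeta ^- 2) ^+ i + (a / r)%:C ^+ 2 * (zeta ^+ 2) ^+ i).
  apply: eq_bigr => k _; rewrite /circle_weight.
  rewrite exprVn -!exprM mulnC exprM; set w := zeta ^+ k.
  have w0 : w != 0 by rewrite expf_neq0.
  rewrite !(rmorphD, rmorphXn, rmorphM, fmorphV, rmorph1) /=.
  by field; rewrite rC0 w0 aC0.
rewrite !big_split /= -mulr_sumr !sum_root_of_unity//.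
- by rewrite mulr0 !addr0 sumr_const card_ord mulrnAr -mulrnAl -(mulr_natr n%:R^-1) mulVf ?mul1r// pnatr_eq0 -lt0n.
- by rewrite -exprM mulnC exprM zn expr1n.
- by rewrite invr_eq1.
- by rewrite exprVn -exprM mulnC exprM zn expr1n invr1.
Qed.

End CircleWeight.

(** * Removing an isolated singularity *)

Section PuncturedDisc.
Variables (R : realType) (V : lmodType R[i]) (p : V -> R) (hp : seminorm p).
Variables (N : {linear V -> V}) (M : R).
Hypotheses (M_gt0 : 0 < M) (NM : forall x, p (N x) <= M * p x).
Hypothesis dissipative : forall l y, `|complex.Re l| * p (N y) <= p (pencil N l y).

Lemma seminorm_comp : seminorm (fun x => p (N x)).
Proof.
split=> [x y|c x]; first by rewrite linearD; exact: seminormD.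
by rewrite linearZ (seminormZ hp).
Qed.

Variables (s0 r : R).
Hypothesis r_gt0 : 0 < r.
Hypothesis regular_below : forall s, 0 < `|s| <= r ->
  exists c, bounded_below p N c (0 +i* (s0 + s)).
Hypothesis regular_range : forall s, `|s| <= r -> dense_range p N (0 +i* (s0 + s)).

Let l (m : R[i]) : R[i] := (0 +i* s0) + m.

Let Re_l m : complex.Re (l m) = complex.Re m.
Proof. by rewrite /l; case: m => x y; simpc. Qed.

Let dense_range_disc m : modulus m <= r -> dense_range p N (l m).
Proof.
move=> mr; have [m0|m0] := eqVneq (complex.Re m) 0; last first.
  by apply: (dense_range_Re hp M_gt0 NM dissipative); rewrite Re_l.
have -> : l m = 0 +i* (s0 + complex.Im m).
  by move: m0; rewrite /l; case: m {mr} => x y /= ->; simpc.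
exact/regular_range/(le_trans (modulus_Im _) mr).
Qed.

Lemma pencil_solution (F : R[i] -> V) (e : R) : 0 < e ->
  exists f : R[i] -> V, forall m, modulus m <= r -> p (pencil N (l m) (f m) - F m) <= e.
Proof.
move=> e0.
have H m : exists y, modulus m <= r -> p (pencil N (l m) y - F m) <= e.
  have [mr|mr] := boolP (modulus m <= r); last by exists 0.
  by have [y hy] := dense_range_disc mr (F m) e0; exists y.
by have [f Hf] := choice H; exists f.
Qed.

(** Differentiating [pencil N (l m) (f m) = g m *: x] in [m], where [f = g F], gives [pencil N (l m)
    (f' m) = g' m *: x + N (f m)]; this is the equation that [f'] solves approximately. *)
Lemma weighted_solution_taylor (a c e : R) (x : V) (F f' : R[i] -> V) :
  0 < a -> a <= r -> 0 < c -> 0 <= e <= 1 ->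
  (forall m, a <= modulus m <= r -> bounded_below p N c (l m)) ->
  (forall m, modulus m <= r -> p (pencil N (l m) (F m) - x) <= e) ->
  (forall m, modulus m <= r -> p (pencil N (l m) (f' m) -
      (circle_weight' a r m *: x + N (circle_weight a r m *: F m))) <= e) ->
  forall m h, a <= modulus m <= r -> a <= modulus (m + h) <= r ->
  p (circle_weight a r (m + h) *: F (m + h) - circle_weight a r m *: F m - h *: f' m) <=
  c * (circle_weight_taylor_cst a r * p x +
       M * (c * ((2 / a + 2 / r) * p x + M * (4 * (c * (p x + 1))) + 1))) * modulus h ^+ 2 +
  c * (8 + 2 * r) * e.
Proof.
move=> a0 ar c0 /andP[e0 e1] bb HF Hf' m h Hm Hk.
set g := circle_weight a r; set g' := circle_weight' a r; set k := m + h in Hk *.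
have /andP[am mr] := Hm; have /andP[ak kr] := Hk.
set rho1 := pencil N (l k) (F k) - x.
set rho0 := pencil N (l m) (F m) - x.
set rho2 := pencil N (l m) (f' m) - (g' m *: x + N (g m *: F m)).
have r1 : p rho1 <= e by exact: HF.
have r0 : p rho0 <= e by exact: HF.
have r2 : p rho2 <= e by exact: Hf'.
have kl y : pencil N (l k) y = pencil N (l m) y - h *: N y.
  by rewrite (pencil_shift _ (l k) (l m)) /l /k; congr (_ - _ *: _); ring.
have px := seminorm_ge0 hp x.
have pF : p (F m) <= c * (p x + 1).
  apply: le_trans (bb _ Hm _) _; rewrite ler_wpM2l ?(ltW c0)//.
  by apply: le_trans (seminorm_leB hp _ x) _; rewrite addrC lerD2l; exact: le_trans r0 e1.
have pf : p (g m *: F m) <= 4 * (c * (p x + 1)).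
  rewrite (seminormZ hp); apply: ler_pM => //; rewrite ?modulus_ge0 ?(seminorm_ge0 hp)//.
  exact: circle_weight_le4.
have pf' : p (f' m) <= c * ((2 / a + 2 / r) * p x + M * (4 * (c * (p x + 1))) + 1).
  apply: le_trans (bb _ Hm _) _; rewrite ler_wpM2l ?(ltW c0)//.
  apply: le_trans (seminorm_leB hp _ (g' m *: x + N (g m *: F m))) _.
  rewrite addrC; apply: lerD; last exact: le_trans r2 e1.
  apply: le_trans (seminormD hp _ _) _; apply: lerD.
    rewrite (seminormZ hp) ler_wpM2r//.
    exact: circle_weight'_le.
  by apply: le_trans (NM _) _; rewrite ler_wpM2l// ltW.
apply: le_trans (bb _ Hk _) _.
rewrite -[c * _ * modulus h ^+ 2]mulrA -[c * _ * e]mulrA -mulrDr ler_wpM2l ?(ltW c0)//.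
(* Applied to the Taylor remainder of [f], the pencil leaves that of the weight, a term in [h^2],
   and the three residuals. The latter cost [4 e + 4 e + 2 r e]. *)
have -> : pencil N (l k) (g k *: F k - g m *: F m - h *: f' m) =
  (g k - g m - h * g' m) *: x + h ^+ 2 *: N (f' m) +
    (g k *: rho1 - g m *: rho0 - h *: rho2).
  rewrite !pencilB !pencilZ.
  have -> : pencil N (l k) (F k) = x + rho1 by rewrite /rho1 subrKC.
  have -> : pencil N (l k) (F m) = x + rho0 - h *: N (F m) by rewrite kl /rho0 subrKC.
  have -> : pencil N (l k) (f' m) = g' m *: x + g m *: N (F m) + rho2 - h *: N (f' m).
    by rewrite kl /rho2 [N (g m *: F m)]linearZ /= subrKC.
  move: (N (F m)) (N (f' m)) rho0 rho1 rho2 r0 r1 r2 => y0 y1 rho0 rho1 rho2 _ _ _.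
  rewrite !scalerBl !(scalerBr, scalerDr) !scalerA [g m * h]mulrC expr2.
  rewrite !opprD !opprK !addrA.
  by rewrite [LHS](ACl (1*3*6*9*2*4*8*(5*7))) /= subrr addr0.
apply: le_trans (seminormD hp _ _) _; apply: lerD.
  apply: le_trans (seminormD hp _ _) _; rewrite mulrDl; apply: lerD.
    rewrite (seminormZ hp) mulrAC ler_wpM2r//.
    by have := circle_weight_taylor a0 ar Hm Hk; rewrite -/k.
  rewrite (seminormZ hp) modulusX mulrC ler_wpM2r ?sqr_ge0//.
  by apply: le_trans (NM _) _; rewrite ler_wpM2l// ltW.
have hr : modulus h <= 2 * r.
  have -> : h = k - m by rewrite /k; ring.
  by apply: le_trans (modulusD _ _) _; rewrite modulusN; lra.
have -> : (8 + 2 * r) * e = 4 * e + 4 * e + 2 * r * e by ring.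
apply: le_trans (seminormB hp _ _) _; apply: lerD.
  apply: le_trans (seminormB hp _ _) _; apply: lerD.
    rewrite (seminormZ hp); apply: ler_pM; rewrite ?modulus_ge0 ?(seminorm_ge0 hp)//.
    exact: circle_weight_le4.
  rewrite (seminormZ hp); apply: ler_pM; rewrite ?modulus_ge0 ?(seminorm_ge0 hp)//.
  exact: circle_weight_le4.
by rewrite (seminormZ hp); apply: ler_pM; rewrite ?modulus_ge0 ?(seminorm_ge0 hp).
Qed.

(** The means of [f = g F], with [F m] solving for [x] at [l m], nearly agree on the two circles. On
    the outer one, dissipativity absorbs the factor [|Re m|] of the weight and leaves [4 / r * p x].
    On the inner one, [N (F m)] is replaced by [N y], which density of the range at the centre
    permits; the weight then averages to [1 + (a/r)^2 >= 1]. *)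
Lemma punctured_disc_bound y : dense_range p N (0 +i* s0) ->
  p (N y) <= 4 / r * p (pencil N (0 +i* s0) y).
Proof.
move=> dr0; set x := pencil N (0 +i* s0) y.
have px := seminorm_ge0 hp x.
have K0 : 0 < M + 20 by apply: addr_gt0.
apply/ler_addgt0Pr => eta' eta'0.
(* The errors are [M * eta] between the circles, [16 * eta] on the inner circle and [4 * eta] from
   the slack on the outer one. *)
pose eta := eta' / (M + 20).
have eta0 : 0 < eta by rewrite divr_gt0.
(* An approximate derivative at the centre: since [pencil N (l m) y = x - m *: N y], the solution
   [F m] is matched by [y + m *: z] up to [m ^+ 2 *: N z] and small residuals. *)
have [z hz] := dr0 (N y) eta eta0.
have pz := seminorm_ge0 hp (N z).
have pz1 : 0 < p (N z) + 1 by rewrite ltr_wpDl.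
pose a := Num.min r (eta / (p (N z) + 1)).
have a0 : 0 < a by rewrite lt_min r_gt0 divr_gt0.
have ar : a <= r by rewrite ge_min lexx.
have az : a * p (N z) <= eta.
  apply: le_trans (_ : a * (p (N z) + 1) <= _).
    by rewrite ler_wpM2l ?(ltW a0)// lerDl.
  by rewrite -ler_pdivlMr// ge_min lexx orbT.
have [c c0 bb] := bounded_below_annulus hp M_gt0 NM dissipative a0 regular_below.
pose C := c * (circle_weight_taylor_cst a r * p x +
  M * (c * ((2 / a + 2 / r) * p x + M * (4 * (c * (p x + 1))) + 1))).
have C0 : 0 <= C.
  have t0 : 0 <= circle_weight_taylor_cst a r.
    by rewrite addr_ge0 ?mulr_ge0 ?invr_ge0 ?exprn_ge0 ?(ltW a0) ?(ltW r_gt0).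
  have A0 : 0 <= 2 / a + 2 / r by rewrite addr_ge0 ?divr_ge0 ?(ltW a0) ?(ltW r_gt0).
  have [c0' M0'] := (ltW c0, ltW M_gt0).
  rewrite /C; move: (circle_weight_taylor_cst a r) (2 / a + 2 / r) t0 A0 => t A t0 A0.
  by do ![assumption | exact: ler0n | exact: ler01 | apply: mulr_ge0 | apply: addr_ge0].
have [n [zeta [e1 [[n0 zu z2 zn e10] close]]]] := circle_mean_close a0 ar C0 eta0.
have B0 : 0 < c * (8 + 2 * r) by rewrite mulr_gt0// addr_gt0// mulr_gt0.
(* The three terms serve the a priori bound on [F m], the slack allowed by [circle_mean_close], and
   the inner circle, where the residual meets the factor [4 / a]. *)
pose e := Num.min (Num.min 1 (e1 / (c * (8 + 2 * r)))) (a * eta).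
have e0 : 0 < e by rewrite !lt_min ltr01 divr_gt0// mulr_gt0.
have ele1 : e <= 1 by rewrite !ge_min lexx.
have ee1 : c * (8 + 2 * r) * e <= e1.
  by rewrite mulrC -ler_pdivlMr// !ge_min lexx orbT.
have ea : e <= a * eta by rewrite !ge_min lexx orbT.
have [F HF] := pencil_solution (fun=> x) e0.
set g := circle_weight a r; pose f m := g m *: F m.
have [f' Hf'] := pencil_solution (fun m => circle_weight' a r m *: x + N (f m)) e0.
have close' : p (circle_mean n zeta f r - circle_mean n zeta f a) <= eta.
  apply: (close V p hp f f') => m h Hm Hk.
  have e01 : 0 <= e <= 1 by rewrite ltW.
  have /= := weighted_solution_taylor a0 ar c0 e01 bb HF Hf' Hm Hk.
  by move=> /le_trans; apply; rewrite lerD2l.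
have hq := seminorm_comp.
have outer : p (N (circle_mean n zeta f r)) <= 4 / r * (p x + e).
  apply: (circle_mean_le hq n0) => k.
  set m := _ * _; have mr : modulus m = r by rewrite /m modulus_circle// ltW.
  rewrite linearZ (seminormZ hp).
  apply: le_trans (_ : 4 / r * `|complex.Re m| * p (N (F m)) <= _).
    by rewrite ler_wpM2r ?(seminorm_ge0 hp)//; exact: circle_weight_outer.
  rewrite -mulrA ler_wpM2l ?divr_ge0 ?(ltW r_gt0)// -(Re_l m).
  apply: le_trans (dissipative _ _) _.
  apply: le_trans (seminorm_leB hp _ x) _; rewrite addrC lerD2l.
  by apply: HF; rewrite mr.
have inner : p (N (circle_mean n zeta (fun m => f m - g m *: y) a)) <= 16 * eta.
  apply: (circle_mean_le hq n0) => k.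
  set m := _ * _; have ma : modulus m = a by rewrite /m modulus_circle// ltW.
  have mr : modulus m <= r by rewrite ma.
  have gm : modulus (g m) <= 4 / a * `|complex.Re m| by exact: circle_weight_inner.
  have gm4 : modulus (g m) <= 4 by apply: circle_weight_le4; rewrite ?ma ?lexx.
  rewrite /f -scalerBr linearZ (seminormZ hp) /=.
  (* One [a * eta] for each term: the residual of [F m], that of [z], and [m ^+ 2 *: N z].
     Multiplied by [4 / a], they give [12 * eta]. *)
  have D : `|complex.Re m| * p (N (F m - y - m *: z)) <= 3 * (a * eta).
    rewrite -(Re_l m); apply: le_trans (dissipative _ _) _.
    have -> : pencil N (l m) (F m - y - m *: z) =
       (pencil N (l m) (F m) - x) - m *: (pencil N (0 +i* s0) z - N y) + m ^+ 2 *: N z.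
      rewrite !pencilB pencilZ; move: (pencil N (l m) (F m)) => P.
      have lE u : pencil N (l m) u = pencil N (0 +i* s0) u - m *: N u.
        by rewrite (pencil_shift _ (l m) (0 +i* s0)) /l; congr (_ - _ *: _); ring.
      rewrite !lE -/x; clearbody x; move: (pencil N _ z) => u; rewrite !scalerBr !scalerA expr2.
      by rewrite !opprB !addrA [LHS](ACl (1*3*2*5*4)).
    apply: le_trans (seminormD hp _ _) _.
    have h1 : p (m ^+ 2 *: N z) <= a * eta.
      rewrite (seminormZ hp) modulusX ma expr2 -mulrA ler_wpM2l// ltW//.
    have h2 : p (m *: (pencil N (0 +i* s0) z - N y)) <= a * eta.
      by rewrite (seminormZ hp) ma ler_wpM2l// ltW.
    have h3 : p (pencil N (l m) (F m) - x) <= e by exact: HF.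
    have := seminormB hp (pencil N (l m) (F m) - x) (m *: (pencil N (0 +i* s0) z - N y)).
    by lra.
  have h4 : p (N (F m - y)) <= p (N (F m - y - m *: z)) + a * p (N z).
    apply: le_trans (seminorm_leB hq _ (m *: z)) _; rewrite lerD2l.
    by rewrite linearZ (seminormZ hp) ma.
  have h5 : modulus (g m) * p (N (F m - y)) <=
      modulus (g m) * p (N (F m - y - m *: z)) + modulus (g m) * (a * p (N z)).
    by rewrite -mulrDr ler_wpM2l ?modulus_ge0.
  have h6 : modulus (g m) * (a * p (N z)) <= 4 * eta.
    by apply: ler_pM; rewrite ?modulus_ge0// mulr_ge0// ltW.
  have h7 : modulus (g m) * p (N (F m - y - m *: z)) <= 12 * eta.
    apply: le_trans (_ : 4 / a * `|complex.Re m| * p (N (F m - y - m *: z)) <= _).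
      by rewrite ler_wpM2r ?(seminorm_ge0 hp).
    apply: le_trans (_ : 4 / a * (3 * (a * eta)) <= _).
      by rewrite -mulrA ler_wpM2l// divr_ge0// ltW.
    by rewrite le_eqVlt; apply/orP; left; apply/eqP; field; rewrite gt_eqF.
  by lra.
have mean_y : circle_mean n zeta (fun m => f m - g m *: y) a =
    circle_mean n zeta f a - (1 + (a / r) ^+ 2)%:C *: y.
  by rewrite -(circle_mean_weight a0 ar y n0 z2 zn) /circle_mean -scalerBr -sumrB.
have py := seminorm_ge0 hp (N y).
have ye : p (N y) <= p (N (circle_mean n zeta f a)) + 16 * eta.
  apply: le_trans (_ : p (N ((1 + (a / r) ^+ 2)%:C *: y)) <= _).
    rewrite linearZ (seminormZ hp) modulus_real ger0_norm ?addr_ge0 ?sqr_ge0//.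
    by rewrite ler_peMl// lerDl sqr_ge0.
  apply: le_trans (seminorm_leB hq _ (circle_mean n zeta f a)) _.
  by rewrite addrC lerD2l (seminorm_distC hq) -mean_y.
have yr : p (N (circle_mean n zeta f a)) <= p (N (circle_mean n zeta f r)) + M * eta.
  apply: le_trans (seminorm_leB hq _ (circle_mean n zeta f r)) _.
  rewrite addrC lerD2l (seminorm_distC hq); apply: le_trans (NM _) _.
  by rewrite ler_wpM2l// ltW.
have er : 4 / r * e <= 4 * eta.
  rewrite -mulrA ler_wpM2l// mulrC ler_pdivrMr// mulrC (le_trans ea)//.
  by rewrite ler_wpM2r// ltW.
have etaE : (M + 20) * eta = eta' by rewrite mulrC divfK// gt_eqF.
rewrite -etaE; move: outer; rewrite mulrDr; lra.
Qed.
End PuncturedDisc.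

(** * Countably many singularities *)

(* Nested intervals: the one chosen at stage [n] avoids the [n]-th point of [E]. *)
Lemma countable_perfect_eq0 (R : realType) (E : set R) : countable E ->
  (forall s, ~ E s -> exists2 d, 0 < d & forall t, `|t - s| < d -> ~ E t) ->
  (forall s d, E s -> 0 < d -> exists t, [/\ E t, t != s & `|t - s| < d]) ->
  E = set0.
Proof.
move=> /countable_injP[f fI] Ecl Eperf.
rewrite -subset0 => s0 Es0.
have [e he] : exists e : nat -> R, forall x, E x -> exists n, e n = x.
  have H (n : nat) : exists y, forall x, E x -> f x = n -> y = x.
    have [[y [Ey fy]]|no] := pselect (exists y, E y /\ f y = n).
      by exists y => x Ex fx; apply: fI; rewrite ?inE// fx fy.
    by exists 0 => x Ex fx; exfalso; apply: no; exists x.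
  have [e he] := choice H; exists e => x Ex.
  by exists (f x); exact: he.
have step (ncd : nat * (R * R)) : exists cd' : R * R, E ncd.2.1 -> 0 < ncd.2.2 ->
    [/\ E cd'.1, 0 < cd'.2, `|cd'.1 - ncd.2.1| + cd'.2 <= ncd.2.2,
        cd'.2 <= ncd.1.+1%:R^-1 & cd'.2 < `|cd'.1 - e ncd.1| ].
  case: ncd => n [c d] /=.
  have [[Ec d0]|no] := pselect (E c /\ 0 < d); last first.
    by exists (0, 0) => Ec d0; exfalso; apply: no.
  have [c' [Ec' ce cc]] : exists c', [/\ E c', c' != e n & `|c' - c| < d / 2].
    have d2 : 0 < d / 2 by rewrite divr_gt0.
    have [ce|ce] := eqVneq c (e n); last by exists c; rewrite subrr normr0.
    have [c' [Ec' ce' cc']] := Eperf c _ Ec d2.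
    by exists c'; rewrite -ce.
  have ce0 : 0 < `|c' - e n| by rewrite normr_gt0 subr_eq0.
  (* Less than the distance to [e n], so the closed interval excludes that point; the bound
     [1 / (n + 1)] makes the radii shrink to 0, so that the limit lies in the closed set [E]. *)
  pose d' := Num.min (Num.min (d / 2) n.+1%:R^-1) (`|c' - e n| / 2).
  have h1 : d' <= d / 2 by rewrite !ge_min lexx.
  have h2 : d' <= n.+1%:R^-1 by rewrite !ge_min lexx orbT.
  have h3 : d' <= `|c' - e n| / 2 by rewrite ge_min lexx orbT.
  exists (c', d') => _ _ /=; split => //; last 2 first.
  - by lra.
  - by lra.
  by rewrite !lt_min invr_gt0 ltr0n !divr_gt0.
have [F hF] := choice step.
pose u := fix u n : R * R := if n is n'.+1 then F (n', u n') else (s0, 1).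
have u_in n : E (u n).1 /\ 0 < (u n).2.
  by elim: n => [|n [IH1 IH2]] //=; have [] := hF (n, u n) IH1 IH2.
have uS n : [/\ `|(u n.+1).1 - (u n).1| + (u n.+1).2 <= (u n).2,
        (u n.+1).2 <= n.+1%:R^-1 & (u n.+1).2 < `|(u n.+1).1 - e n| ].
  by have [h1 h2] := u_in n; have [] := hF (n, u n) h1 h2.
have mono n k : (u n).1 - (u n).2 <= (u (n + k)%N).1 - (u (n + k)%N).2 /\
    (u (n + k)%N).1 + (u (n + k)%N).2 <= (u n).1 + (u n).2.
  elim: k => [|k [IH1 IH2]]; first by rewrite addn0.
  rewrite addnS; have [h _ _] := uS (n + k)%N.
  have := ler_norm ((u (n + k).+1).1 - (u (n + k)%N).1).
  have := ler_norm (- ((u (n + k).+1).1 - (u (n + k)%N).1)).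
  by rewrite normrN; lra.
pose S := [set (u n).1 - (u n).2 | n in [set: nat]].
have ubS m : ubound S ((u m).1 + (u m).2).
  move=> _ [n _ <-].
  have [_ hn] := u_in (m + n)%N; have [a1 _] := mono n m; have [_ a2] := mono m n.
  by rewrite addnC in a1; lra.
have supS : has_sup S.
  by split; [exists ((u 0%N).1 - (u 0%N).2); exists 0%N | exists ((u 0%N).1 + (u 0%N).2)].
pose x := sup S.
have xu n : `|x - (u n).1| <= (u n).2.
  have lo : (u n).1 - (u n).2 <= x by apply: ub_le_sup; [case: supS | exists n].
  have hi : x <= (u n).1 + (u n).2 by apply: ge_sup (ubS n); case: supS.
  by rewrite ler_norml; lra.
have Ex : E x.
  apply: contrapT => /Ecl[d d0 hd].
  have [n hn] : exists n : nat, n.+1%:R^-1 < d.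
    exists (Num.truncn d^-1); rewrite -[ltRHS]invrK ltf_pV2 ?posrE ?invr_gt0// truncnS_gt//.
  have [E1 _] := u_in n.+1; have [_ h _] := uS n.
  apply: (hd _ _ E1); rewrite distrC.
  exact: le_lt_trans (le_trans (xu n.+1) h) hn.
have [n en] := he x Ex.
have [_ _] := uS n; have := xu n.+1; rewrite distrC -en; lra.
Qed.

Section CountableSingularities.
Variables (R : realType) (V : lmodType R[i]) (p : V -> R) (hp : seminorm p).
Variables (N : {linear V -> V}) (M : R).
Hypotheses (M_gt0 : 0 < M) (NM : forall x, p (N x) <= M * p x).
Hypothesis dissipative : forall l y, `|complex.Re l| * p (N y) <= p (pencil N l y).

Lemma countable_singularities_eq0 :
  countable [set s : R | ~ exists c, bounded_below p N c (0 +i* s)] ->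
  (forall s : R, dense_range p N (0 +i* s)) ->
  forall y, p (N y) = 0.
Proof.
move=> cE dr.
have E0 : [set s : R | ~ exists c, bounded_below p N c (0 +i* s)] = set0.
  apply: countable_perfect_eq0 => //.
    move=> s /= /contrapT[c hc].
    pose c1 := Num.max c 1; have c0 : 0 < c1 by rewrite lt_max ltr01 orbT.
    have hc1 : bounded_below p N c1 (0 +i* s) by apply: (bounded_belowW hp _ hc); rewrite le_max lexx.
    have cM : 0 < c1 * M by exact: mulr_gt0.
    exists (2^-1 / (c1 * M)); first by rewrite divr_gt0.
    move=> t ts; apply; exists (2 * c1).
    apply: (bounded_below_near hp NM c0 _ hc1).
    have -> : (0 +i* t) - (0 +i* s) = 0 +i* (t - s) by simpc.
    by rewrite modulus_imag -ler_pdivlMr// ltW.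
  move=> s d /= Es d0; apply: contrapT => no; apply: Es.
  pose r := d / 2; have r0 : 0 < r by rewrite divr_gt0.
  have H y : p (N y) <= 4 / r * p (pencil N (0 +i* s) y).
    apply: (punctured_disc_bound hp M_gt0 NM dissipative) => //.
    move=> t /andP[t0 tr]; apply: contrapT => nt; apply: no; exists (s + t); split => //.
      by rewrite -subr_eq0 addrAC subrr add0r -normr_gt0.
    by rewrite addrAC subrr add0r (le_lt_trans tr)// /r; lra.
  exists (1 + `|s| * (4 / r)) => y.
  apply: le_trans (_ : p (pencil N (0 +i* s) y) + `|s| * p (N y) <= _).
    rewrite -{1}(subrK ((0 +i* s) *: N y) y) -modulus_imag -(seminormZ hp).
    exact: seminormD.
  by rewrite mulrDl mul1r lerD2l -mulrA ler_wpM2l.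
move=> y; apply/eqP; rewrite eq_le (seminorm_ge0 hp) andbT.
have py := seminorm_ge0 hp y.
apply/ler_addgt0Pr => e e0; rewrite add0r.
(* The disc is centred at 0, where the pencil is the identity: the bound reads
   [p (N y) <= 4 / r * p y], which this radius makes at most [e], also if [p y = 0]. *)
pose r := 4 * (p y + 1) / e.
have r0 : 0 < r by rewrite divr_gt0// mulr_gt0// ltr_wpDl.
have := @punctured_disc_bound _ _ _ hp N M M_gt0 NM dissipative 0 r r0 _ _ y (dr 0).
have -> : pencil N (0 +i* 0) y = y by rewrite /pencil scale0r subr0.
move=> /(_ _ _)/le_trans; apply.
- move=> s _; rewrite add0r; apply: contrapT => ns.
  by have : set0 s by rewrite -E0.
- by move=> s _; rewrite add0r.
have py1 : 0 < p y + 1 by rewrite ltr_wpDl.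
have -> : 4 / r * p y = e * (p y / (p y + 1)) by rewrite /r; field; rewrite !gt_eqF.
by rewrite ler_piMr ?(ltW e0)// ler_pdivrMr// mul1r lerDl.
Qed.

End CountableSingularities.

(** * The seminorm of a semigroup *)

Section Rnorm.
Variables (R : realType) (X : normedModType R[i]).
Implicit Types x y : X.

Lemma normr_rnorm x : `|x| = (rnorm x)%:C.
Proof. by rewrite /rnorm RRe_real// ger0_real. Qed.

Lemma rnorm_seminorm : seminorm (@rnorm R X).
Proof.
split=> [x y|a x]; first by rewrite -lecR rmorphD /= -!normr_rnorm ler_normD.
by apply: complexI; rewrite rmorphM /= -!normr_rnorm -normr_modulus normrZ.
Qed.

Lemma normr_lt x (e : R) : (`|x| < e%:C) = (rnorm x < e).
Proof. by rewrite normr_rnorm ltcR. Qed.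

Lemma nbhs_rnormP x (P : set X) :
  nbhs x P <-> exists2 e : R, 0 < e & forall y, rnorm (y - x) < e -> P y.
Proof.
split.
  move=> /nbhs_ballP[e /= e0 H]; exists (complex.Re e).
    by move: e0; rewrite ltcE => /andP[_].
  move=> y hy; apply: H; rewrite -ball_normE /= distrC normr_rnorm.
  by move: e0; rewrite !ltcE /= => /andP[/eqP -> _]; rewrite eqxx.
move=> [e e0 H]; apply/nbhs_ballP; exists e%:C; first by rewrite /= ltcR.
by move=> y; rewrite -ball_normE /= distrC normr_lt; exact: H.
Qed.

Lemma at_right_rnormP (f : R -> X) (l : X) :
  f h @[h --> 0^'+] --> l <-> forall e : R, 0 < e ->
    exists2 d : R, 0 < d & forall h, 0 < h -> h < d -> rnorm (f h - l) < e.
Proof.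
split.
  move=> H e e0.
  have : \forall h \near 0^'+, rnorm (f h - l) < e.
    by apply: (H [set y | rnorm (y - l) < e]); apply/nbhs_rnormP; exists e.
  rewrite near_withinE => /nbhs_ballP[d /= d0 Hd].
  exists d => // h h0 hd; apply: Hd => //.
  by rewrite /ball /= sub0r normrN gtr0_norm.
move=> H P /nbhs_rnormP[e e0 He].
have [d d0 Hd] := H e e0.
suff : \forall h \near 0^'+, P (f h) by [].
rewrite near_withinE; apply/nbhs_ballP; exists d => //= h.
by rewrite /ball /= sub0r normrN => hd h0; apply/He/Hd => //; rewrite -(gtr0_norm h0).
Qed.

Lemma bounded_linear_ge0 (W : normedModType R[i]) (S : X -> W) : bounded_linear S ->
  exists2 K, 0 <= K & forall x, rnorm (S x) <= K * rnorm x.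
Proof.
move=> [_ [K HK]]; exists (Num.max K 0); first by rewrite le_max lexx orbT.
move=> x; apply: le_trans (HK x) _; rewrite ler_wpM2r ?le_max ?lexx//.
exact: (seminorm_ge0 rnorm_seminorm).
Qed.

Lemma rnorm_le_opnorm (S : X -> X) x : bounded_linear S -> rnorm (S x) <= opnorm S * rnorm x.
Proof.
move=> hS; have [K K0 HK] := bounded_linear_ge0 hS; case: hS => linS _.
pose S' : {linear X -> X} := HB.pack S (GRing.isLinear.Build _ _ _ _ S linS).
have hn := rnorm_seminorm; have x0 := seminorm_ge0 hn x.
have ub : has_ubound [set rnorm (S x) | x in [set x | rnorm x <= 1]].
  exists K => _ [y /= y1 <-]; apply: le_trans (HK y) _.
  by rewrite ler_piMr.
move: x0; rewrite le_eqVlt => /predU1P[x0|x0].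
  by have := HK x; rewrite -x0 !mulr0.
rewrite -ler_pdivrMr//.
have -> : rnorm (S x) / rnorm x = rnorm (S ((rnorm x)^-1%:C *: x)).
  rewrite -[S]/(S' : X -> X) linearZ (seminormZ hn) modulus_real ger0_norm ?invr_ge0 ?(ltW x0)//.
  by rewrite mulrC.
apply: ub_le_sup => //; exists ((rnorm x)^-1%:C *: x) => //=.
by rewrite (seminormZ hn) modulus_real ger0_norm ?invr_ge0 ?(ltW x0)// mulVf// gt_eqF.
Qed.

End Rnorm.

Section OrbitSeminorm.
Variables (R : realType) (X : normedModType R[i]) (T : R -> X -> X) (u : R -> R).
Hypothesis T_semigroup : C0_semigroup T.
Hypothesis u_gt0 : forall t, 0 < u t.
Hypothesis T_le : forall t x, 0 <= t -> rnorm (T t x) <= u t * rnorm x.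
Hypothesis u_shift : forall s d : R, 0 <= s -> 0 < d -> exists t0 : R, forall t, t0 <= t ->
  u (t + s) <= (1 + d) * u t /\ u t <= (1 + d) * u (t + s).

Definition orbit_bound (x : X) (c : R) := 0 <= c /\
  exists t0 : R, forall t, t0 <= t -> 0 <= t -> rnorm (T t x) <= c * u t.

(* This is [limsup ||T t x|| / u t] at infinity. *)
Definition orbit_seminorm (x : X) : R := inf (orbit_bound x).

Let hn := @rnorm_seminorm R X.

Lemma orbit_bound_rnorm x : orbit_bound x (rnorm x).
Proof.
split; first exact: (seminorm_ge0 hn).
by exists 0 => t _ t0; rewrite mulrC; exact: T_le.
Qed.

Lemma orbit_seminorm_le x c : orbit_bound x c -> orbit_seminorm x <= c.
Proof. by move=> h; apply: ge_inf => //; exists 0 => y []. Qed.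

Lemma orbit_bound_gt x c : orbit_seminorm x < c -> orbit_bound x c.
Proof.
move=> /inf_lt[|d [d0 [t0 h]] dc].
  by exists (rnorm x); exact: orbit_bound_rnorm.
split; first exact: le_trans (ltW dc).
exists t0 => t t1 t2; apply: le_trans (h t t1 t2) _.
by rewrite ler_wpM2r// ltW.
Qed.

Lemma orbit_seminorm_ge x c : (forall d, orbit_bound x d -> c <= d) -> c <= orbit_seminorm x.
Proof.
by move=> h; apply: lb_le_inf => //; exists (rnorm x); exact: orbit_bound_rnorm.
Qed.

Lemma orbit_seminorm_rnorm x : orbit_seminorm x <= rnorm x.
Proof. exact/orbit_seminorm_le/orbit_bound_rnorm. Qed.

Lemma semigroup_linear t : 0 <= t -> linear (T t).
Proof. by move=> /(semigroup_bounded T_semigroup)[]. Qed.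

Lemma semigroup_add t x y : 0 <= t -> T t (x + y) = T t x + T t y.
Proof. by move=> /semigroup_linear /(_ 1 x y); rewrite !scale1r. Qed.

Lemma semigroup_zero t : 0 <= t -> T t 0 = 0.
Proof. by move=> t0; apply/(addrI (T t 0)); rewrite -semigroup_add// !addr0. Qed.

Lemma semigroup_scale t a x : 0 <= t -> T t (a *: x) = a *: T t x.
Proof.
move=> t0; have := semigroup_linear t0 a x 0.
by rewrite !addr0 semigroup_zero// addr0.
Qed.

Lemma semigroup_sub t x y : 0 <= t -> T t (x - y) = T t x - T t y.
Proof. by move=> t0; rewrite semigroup_add// -scaleN1r semigroup_scale// scaleN1r. Qed.

Lemma orbit_boundZ a x c : orbit_bound x c -> orbit_bound (a *: x) (modulus a * c).
Proof.
move=> [c0 [t0 h]]; split; first by rewrite mulr_ge0// modulus_ge0.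
exists t0 => t t1 t2; rewrite semigroup_scale// (seminormZ hn) -mulrA.
by rewrite ler_wpM2l ?modulus_ge0// h.
Qed.

Lemma orbit_seminorm_seminorm : seminorm orbit_seminorm.
Proof.
split=> [x y|a x].
  apply/ler_addgt0Pr => e e0.
  have e2 : 0 < e / 2 by rewrite divr_gt0.
  have [c0 [t0 h]] : orbit_bound x (orbit_seminorm x + e / 2).
    by apply: orbit_bound_gt; rewrite ltrDl.
  have [c1 [t1 h']] : orbit_bound y (orbit_seminorm y + e / 2).
    by apply: orbit_bound_gt; rewrite ltrDl.
  rewrite [e]splitr addrACA; apply: orbit_seminorm_le; split; first exact: addr_ge0.
  exists (Num.max t0 t1) => t; rewrite ge_max => /andP[ht0 ht1] t2.
  rewrite semigroup_add// (le_trans (seminormD hn _ _))// mulrDl.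
  by apply: lerD; [exact: h | exact: h'].
have le b z : orbit_seminorm (b *: z) <= modulus b * orbit_seminorm z.
  have [->|b0] := eqVneq b 0.
    rewrite scale0r modulus0 mul0r; apply: le_trans (orbit_seminorm_rnorm _) _.
    by rewrite (seminorm0 hn).
  have mb : 0 < modulus b by rewrite modulus_gt0.
  rewrite -ler_pdivrMl//; apply: orbit_seminorm_ge => d hd.
  by rewrite ler_pdivrMl//; exact/orbit_seminorm_le/orbit_boundZ.
apply/eqP; rewrite eq_le le /=.
have [->|a0] := eqVneq a 0.
  rewrite modulus0 mul0r; apply: orbit_seminorm_ge => d; by case.
have ma : 0 < modulus a by rewrite modulus_gt0.
rewrite -ler_pdivlMl// -modulusV; apply: le_trans (le _ _).
by rewrite scalerA mulVf// scale1r.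
Qed.


Lemma orbit_seminorm_semigroup s x : 0 <= s -> orbit_seminorm (T s x) = orbit_seminorm x.
Proof.
move=> s0.
have slack (c e : R) : 0 <= c -> 0 < e -> c * (1 + e / (c + 1)) <= c + e.
  move=> c0 e0; have c1 : 0 < c + 1 by rewrite ltr_wpDl.
  rewrite mulrDr mulr1 lerD2l mulrCA ler_piMr ?(ltW e0)// ler_pdivrMr// mul1r.
  by rewrite lerDl.
apply/eqP; rewrite eq_le; apply/andP; split; apply: orbit_seminorm_ge => c [c0 [t0 h]];
  apply/ler_addgt0Pr => e e0; apply: le_trans (slack c e c0 e0);
  have d0 : 0 < e / (c + 1) by [rewrite divr_gt0// ltr_wpDl];
  have [t1 h1] := u_shift s0 d0; apply: orbit_seminorm_le;
  (split; first by rewrite mulr_ge0// addr_ge0// ltW).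
  exists (Num.max t0 t1) => t; rewrite ge_max => /andP[ht0 ht1] t2.
  rewrite -(semigroupD T_semigroup)//.
  apply: le_trans (h _ _ _) _; rewrite ?addr_ge0//; first by rewrite ler_wpDr.
  by rewrite -mulrA ler_wpM2l//; have [] := h1 t ht1.
(* For the reverse inequality the bound on the orbit of [T s x] is read at time [t - s], which must
   be nonnegative and beyond both thresholds. *)
exists (Num.max (Num.max t0 t1) 0 + s) => t.
rewrite -lerBrDr !ge_max => /andP[/andP[ht0 ht1] ts] _.
have tE : t = t - s + s by rewrite subrK.
rewrite tE (semigroupD T_semigroup)//.
apply: le_trans (h _ _ _) _ => //.
by rewrite -mulrA ler_wpM2l//; have [] := h1 _ ht1.
Qed.

(** A norm bound on [S] does not by itself control [p], which may be far below the norm; commutation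
    lets it act along the orbit. This is applied to resolvents of the generator. *)
Lemma orbit_seminorm_comm (S : X -> X) K x : 0 <= K ->
  (forall y, rnorm (S y) <= K * rnorm y) ->
  (forall t, 0 <= t -> S (T t x) = T t (S x)) ->
  orbit_seminorm (S x) <= K * orbit_seminorm x.
Proof.
move=> K0 SK comm.
have H c : orbit_bound x c -> orbit_seminorm (S x) <= K * c.
  move=> [c0 [t0 h]]; apply: orbit_seminorm_le; split; first exact: mulr_ge0.
  exists t0 => t t1 t2; rewrite -comm//; apply: le_trans (SK _) _.
  by rewrite -mulrA ler_wpM2l// h.
move: K0; rewrite le_eqVlt => /predU1P[K0|K0].
  by have := H _ (orbit_bound_rnorm x); rewrite -K0 !mul0r.
rewrite -ler_pdivrMl//; apply: orbit_seminorm_ge => c /H.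
by rewrite ler_pdivrMl.
Qed.

Lemma orbit_seminorm0_cvg x : orbit_seminorm x = 0 -> rnorm (T t x) / u t @[t --> +oo] --> 0.
Proof.
move=> px; apply/cvgrPdist_lt => e e0.
have e2 : 0 < e / 2 by rewrite divr_gt0.
have [_ [t0 h]] : orbit_bound x (e / 2) by apply: orbit_bound_gt; rewrite px.
exists (Num.max t0 0); split; first by rewrite num_real.
move=> t /=; rewrite gt_max => /andP[t1 t2].
rewrite sub0r normrN ger0_norm ?divr_ge0 ?(seminorm_ge0 hn) ?(ltW (u_gt0 t))//.
rewrite (@le_lt_trans _ _ (e / 2))//; last by lra.
by rewrite ler_pdivrMr// h// ltW.
Qed.

End OrbitSeminorm.

(** * The generator and dissipativity for an invariant seminorm *)

Section Generator.
Variables (R : realType) (X : normedModType R[i]) (T : R -> X -> X).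
Hypothesis T_semigroup : C0_semigroup T.
Let A := generator T.
Let hn := @rnorm_seminorm R X.

Lemma generatorP x y : (dom A x /\ A x = y) <->
  (forall e : R, 0 < e -> exists2 d : R, 0 < d &
     forall h, 0 < h -> h < d -> rnorm (difference_quotient T x h - y) < e).
Proof.
rewrite -at_right_rnormP; split=> [[/= dx <-]|H]; first exact: dx.
split; first by apply/cvg_ex; exists y.
exact: cvg_lim.
Qed.

Lemma generator_approx x (e : R) : dom A x -> 0 < e -> exists2 d : R, 0 < d &
  forall h, 0 < h -> h < d -> exists2 r, rnorm r <= e & T h x = x + h%:C *: (A x + r).
Proof.
move=> dx e0; have [/(_ (conj dx erefl) e e0)[d d0 H] _] := generatorP x (A x).
exists d => // h h0 hd; exists (difference_quotient T x h - A x); first exact/ltW/H.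
rewrite subrKC /difference_quotient scalerA -rmorphM /= divff ?gt_eqF// scale1r.
by rewrite subrKC.
Qed.

Lemma generator_semigroup s x : 0 <= s -> dom A x -> dom A (T s x) /\ A (T s x) = T s (A x).
Proof.
move=> s0 dx; apply/generatorP => e e0.
have [K K0 HK] := bounded_linear_ge0 (semigroup_bounded T_semigroup s0).
have K1 : 0 < K + 1 by rewrite ltr_wpDl.
have [/(_ (conj dx erefl) _ (divr_gt0 e0 K1))[d d0 H] _] := generatorP x (A x).
exists d => // h h0 hd.
have -> : difference_quotient T (T s x) h = T s (difference_quotient T x h).
  rewrite /difference_quotient (semigroup_scale T_semigroup)// (semigroup_sub T_semigroup)//.
  by rewrite -!(semigroupD T_semigroup) ?(ltW h0)// [h + s]addrC.
rewrite -(semigroup_sub T_semigroup)//; apply: le_lt_trans (HK _) _.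
have := H h h0 hd; rewrite ltr_pdivlMr// => /(le_lt_trans _); apply.
by rewrite mulrC ler_wpM2l ?lerDl// (seminorm_ge0 hn).
Qed.

Lemma resolvent_semigroup l (S : X -> X) s x : 0 <= s ->
  (forall y, dom A (S y) /\ opshift A l (S y) = y) ->
  (forall x, dom A x -> S (opshift A l x) = x) -> S (T s x) = T s (S x).
Proof.
move=> s0 HS1 HS2; have [dS AS] := HS1 x.
have [dT AT] := generator_semigroup s0 dS.
have -> : T s x = A (T s (S x)) - l *: T s (S x).
  rewrite AT -(semigroup_scale T_semigroup)// -(semigroup_sub T_semigroup)//.
  by congr (T s _); rewrite -{1}AS.
exact: (HS2 _ dT).
Qed.

Section Seminorm.
Variable p : X -> R.
Hypotheses (hp : seminorm p) (p_le : forall x, p x <= rnorm x).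
Hypothesis pT : forall (s : R) x, 0 <= s -> p (T s x) = p x.

(** To first order, [(1 + h l) x] is [T h x - h (A x - l x)], while [p (T h x) = p x] and
    [|1 + h l| >= 1 + h Re l]. Dividing by [h] settles [Re l >= 0]; for [Re l < 0] the semigroup is
    read backwards, from [T h x] to [x]. *)
Lemma generator_dissipative l x : dom A x ->
  `|complex.Re l| * p x <= p (A x - l *: x).
Proof.
move=> dx; have px := seminorm_ge0 hp x; have pAx := seminorm_ge0 hp (A x).
set z := A x - l *: x.
have ml := modulus_ge0 l.
have L0 : 0 < 1 + modulus l * (p (A x) + 1) by rewrite ltr_pwDl// mulr_ge0// addr_ge0.
apply/ler_addgt0Pr => e0' e0'0.
pose e := Num.min 1 (e0' / 2).
have e0 : 0 < e by rewrite lt_min ltr01 divr_gt0.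
have e1 : e <= 1 by rewrite ge_min lexx.
have e2 : e <= e0' / 2 by rewrite ge_min lexx orbT.
have [d d0 H] := generator_approx dx e0.
pose h := Num.min (d / 2) (e0' / 2 / (1 + modulus l * (p (A x) + 1))).
have h0 : 0 < h by rewrite lt_min !divr_gt0.
have hd : h < d by rewrite gt_min; apply/orP; left; lra.
have hL : h * (1 + modulus l * (p (A x) + 1)) <= e0' / 2.
  by rewrite -ler_pdivlMr// ge_min lexx orbT.
have [r hr Tx] := H h h0 hd.
have pr : p r <= e by exact: le_trans (p_le r) hr.
have mh : modulus h%:C = h by rewrite modulus_real gtr0_norm.
have pTx := pT x (ltW h0).
have ReE : complex.Re (h%:C * l) = h * complex.Re l by case: (l) => a b /=; ring.
case: (ger0P (complex.Re l)) => lr.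
  have h1 : 1 + h * complex.Re l <= modulus (1 + h%:C * l).
    by apply: le_trans (Re_le_modulus _); rewrite -ReE; case: (h%:C * l).
  have : p ((1 + h%:C * l) *: x) <= p (T h x) + h * (p z + e).
    have -> : (1 + h%:C * l) *: x = T h x - h%:C *: (z + r).
      rewrite Tx /z [A x - _ + r]addrAC scalerBr; move: (h%:C *: (A x + r)) => y.
      by rewrite opprB addrA [x + y + _]addrAC addrK scalerDl scale1r scalerA.
    apply: le_trans (seminormB hp _ _) _; rewrite lerD2l (seminormZ hp) mh.
    rewrite ler_wpM2l ?(ltW h0)//; apply: le_trans (seminormD hp _ _) _.
    by rewrite lerD2l.
  rewrite (seminormZ hp) pTx => h2.
  have h3 : (1 + h * complex.Re l) * p x <= modulus (1 + h%:C * l) * p x by exact: ler_wpM2r.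
  have : h * (complex.Re l * p x) <= h * (p z + e) by lra.
  by rewrite ler_pM2l//; lra.
(* Replacing [x] by [T h x] in the term [h l x] costs the second-order term [h |l| p (T h x - x)];
   the second bound on [h] controls it. *)
have h1 : 1 - h * complex.Re l <= modulus (1 - h%:C * l).
  by apply: le_trans (Re_le_modulus _); rewrite -ReE; case: (h%:C * l).
have pTxx : p (T h x - x) <= h * (p (A x) + 1).
  rewrite Tx addrAC subrr add0r (seminormZ hp) mh ler_wpM2l ?(ltW h0)//.
  by apply: le_trans (seminormD hp _ _) _; rewrite lerD2l (le_trans pr).
have : p ((1 - h%:C * l) *: T h x) <= p x + h * (p z + e) + h * (modulus l * (h * (p (A x) + 1))).
  have -> : (1 - h%:C * l) *: T h x = x + h%:C *: (z + r) - h%:C *: (l *: (T h x - x)).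
    rewrite scalerBl scale1r -scalerA {1}Tx -[LHS]addrA -[RHS]addrA; congr (x + _).
    rewrite -!scalerBr; congr (_ *: _).
    by rewrite scalerBr opprB /z !addrA [RHS](ACl (1*3*5*(2*4)))/= addNr addr0.
  apply: le_trans (seminormB hp _ _) _; apply: lerD.
    apply: le_trans (seminormD hp _ _) _; rewrite lerD2l (seminormZ hp) mh.
    rewrite ler_wpM2l ?(ltW h0)//; apply: le_trans (seminormD hp _ _) _.
    by rewrite lerD2l.
  rewrite !(seminormZ hp) mh !ler_wpM2l ?(ltW h0)//.
rewrite (seminormZ hp) pTx => h2.
have h3 : (1 - h * complex.Re l) * p x <= modulus (1 - h%:C * l) * p x by exact: ler_wpM2r.
have : h * (- complex.Re l * p x) <= h * (p z + e + modulus l * (h * (p (A x) + 1))) by lra.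
rewrite ler_pM2l// => h4; apply: le_trans h4 _.
have h5 : modulus l * (h * (p (A x) + 1)) <= e0' / 2.
  by apply: le_trans hL; move: (p (A x) + 1) => Q; rewrite mulrDr mulr1 mulrCA lerDr ltW.
by lra.
Qed.

(** For [p], which is at most the norm, [A x] is a limit of difference quotients, and these are null
    because [p (T h x) = p x = 0]. *)
Lemma seminorm_eq0_dom : (forall x, dom A x -> p x = 0) -> forall x, dom A x -> p (A x) = 0.
Proof.
move=> H x dx; apply/eqP; rewrite eq_le (seminorm_ge0 hp) andbT.
apply/ler_addgt0Pr => e e0; rewrite add0r.
have [d d0 Hd] := generator_approx dx e0.
have h0 : 0 < d / 2 by rewrite divr_gt0.
have hd : d / 2 < d by lra.
have [r hr Tx] := Hd _ h0 hd.
have pr : p r <= e by exact: le_trans (p_le r) hr.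
have : p ((d / 2)%:C *: (A x + r)) <= 0.
  have -> : (d / 2)%:C *: (A x + r) = T (d / 2) x - x by rewrite Tx addrAC subrr add0r.
  apply: le_trans (seminormB hp _ _) _.
  by rewrite pT ?(ltW h0)// H// addr0.
rewrite (seminormZ hp) modulus_real gtr0_norm// pmulr_rle0// => h1.
apply: le_trans (seminorm_leB hp _ (- r)) _.
by rewrite opprK (seminormN hp); lra.
Qed.

End Seminorm.

End Generator.

(** * Vanishing of an invariant seminorm *)

Section Stability.
Variables (R : realType) (X : normedModType R[i]) (T : R -> X -> X).
Hypothesis T_semigroup : C0_semigroup T.
Let A := generator T.
Variable p : X -> R.
Hypotheses (hp : seminorm p) (p_le : forall x, p x <= rnorm x).
Hypothesis pT : forall (s : R) x, 0 <= s -> p (T s x) = p x.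
Hypothesis p_comm : forall (S : X -> X) (K : R) x, 0 <= K ->
  (forall y, rnorm (S y) <= K * rnorm y) ->
  (forall t : R, 0 <= t -> S (T t x) = T t (S x)) -> p (S x) <= K * p x.
Hypothesis spectrum_countable : countable (spectrum A `&` imaginary_axis R).

(** Otherwise the spectrum would contain the whole axis and the real line would be countable;
    [countable_perfect_eq0], applied to the line itself, excludes this. *)
Lemma exists_imaginary_resolvent : exists s : R, resolvent_set A (0 +i* s).
Proof.
apply: contrapT => no.
have all s : spectrum A (0 +i* s) by move=> rs; apply: no; exists s.
have : countable [set: R].
  apply: sub_countable spectrum_countable.
  apply: card_le_trans (_ : ([set complex.Im z | z in spectrum A `&` imaginary_axis R] #<= _)%card).
    by apply: subset_card_le => s _; exists (0 +i* s) => //; split; [exact: all | exists s].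
  exact: card_image_le.
move=> /countable_perfect_eq0 E0.
have : [set: R] = set0.
  apply: E0 => [s /(_ I)//|s d _ d0].
  exists (s + d / 2); split => //.
    by rewrite -subr_eq0 addrAC subrr add0r gt_eqF// divr_gt0.
  by rewrite addrAC subrr add0r gtr0_norm ?divr_gt0//; lra.
by move=> E; have : [set: R] 0 by []; rewrite E.
Qed.

Lemma orbit_seminorm_trivial :
  (forall (s : R) x (e : R), 0 < e -> exists z, dom A z /\ p (A z - (0 +i* s) *: z - x) <= e) ->
  forall x, p x = 0.
Proof.
move=> dr.
have [s1 [S [hS AS SA]]] := exists_imaginary_resolvent.
have linS := hS.1.
pose N : {linear X -> X} := HB.pack S (GRing.isLinear.Build _ _ _ _ S linS).
have [M M0 SM] := bounded_linear_ge0 hS.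
have comm t x : 0 <= t -> N (T t x) = T t (N x).
  by move=> t0; exact: (resolvent_semigroup T_semigroup x t0 AS SA).
have NM x : p (N x) <= (M + 1) * p x.
  apply: le_trans (_ : M * p x <= _); first by apply: p_comm => // t t0; exact: comm.
  by rewrite ler_wpM2r ?lerDl// (seminorm_ge0 hp).
have pencilE l y : pencil N l y = opshift A (0 +i* s1 + l) (N y).
  rewrite /opshift /= scalerDl opprD addrA.
  by have [_ /= ->] := AS y.
have diss l y : `|complex.Re l| * p (N y) <= p (pencil N l y).
  rewrite pencilE; have [dN _] := AS y.
  have := generator_dissipative hp p_le pT (0 +i* s1 + l) dN.
  by case: (l) => a b /=; rewrite add0r.
have N0 y : p (N y) = 0.
  apply: (@countable_singularities_eq0 _ _ p hp N (M + 1) _ NM diss) => //.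
  - by rewrite ltr_wpDl.
  (* If [i (s1 + s)] is outside the spectrum, its resolvent [S'] satisfies
     [N z = S' (pencil N (0 +i* s) z)] and is bounded for [p], so [s] is not singular. The
     singularities thus inject, by translation, into the spectrum on the axis. *)
  - apply: sub_countable spectrum_countable.
    apply: card_le_trans (_ : ([set complex.Im z - s1 | z in spectrum A `&` imaginary_axis R] #<= _)%card).
      apply: subset_card_le => s /= Es; exists (0 +i* (s1 + s)); last by rewrite /= addrAC subrr add0r.
      split; last by exists (s1 + s).
      move=> [S' [hS' AS' SA']]; apply: Es.
      have [K K0 S'K] := bounded_linear_ge0 hS'.
      exists (1 + `|s| * K) => z.
      apply: le_trans (_ : p (pencil N (0 +i* s) z) + `|s| * p (N z) <= _).
        rewrite -{1}(subrK ((0 +i* s) *: N z) z) -modulus_imag -(seminormZ hp).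
        exact: seminormD.
      rewrite mulrDl mul1r lerD2l -mulrA ler_wpM2l//.
      have [dN _] := AS z.
      have -> : N z = S' (pencil N (0 +i* s) z).
        rewrite pencilE (_ : (0 +i* s1) + (0 +i* s) = 0 +i* (s1 + s)); last by simpc.
        by rewrite SA'.
      apply: p_comm => // t t0.
      exact: (resolvent_semigroup T_semigroup _ t0 AS' SA').
    exact: card_image_le.
  - move=> s x e e0; have [z [dz hz]] := dr (s1 + s) x e e0.
    exists (opshift A (0 +i* s1) z); rewrite pencilE.
    have -> : N (opshift A (0 +i* s1) z) = z by exact: SA.
    by rewrite (_ : (0 +i* s1) + (0 +i* s) = 0 +i* (s1 + s)); last by simpc.
(* The range of [N] is the domain of [A]; every [x] is then reached as [A y - i s1 y] with [y = S x]
   in the domain. *)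
have dom0 x : dom A x -> p x = 0 by move=> dx; rewrite -(SA x dx) N0.
have A0 := seminorm_eq0_dom hp p_le pT dom0.
move=> x; have [dx /= Ax] := AS x.
apply/eqP; rewrite eq_le (seminorm_ge0 hp) andbT -[X in p X]Ax.
apply: le_trans (seminormB hp _ _) _.
by rewrite (seminormZ hp) (dom0 _ dx) mulr0 addr0 A0.
Qed.

End Stability.

(** * Separation and kernels *)

Section HahnBanach.
Variables (R : realType) (V : lmodType R[i]) (q : V -> R) (hq : seminorm q) (x0 : V).

(* Graph of a real-linear functional dominated by [q], defined on a subspace
   and taking the value [q x0] at [x0]; the empty graph is included for Zorn's lemma. *)
Definition dominated_graph (G : set (V * R)) : Prop :=
  [/\ forall y z, G y -> G z -> G (y.1 + z.1, y.2 + z.2),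
      forall (t : R) y, G y -> G (t%:C *: y.1, t * y.2),
      forall y, G y -> y.2 <= q y.1 &
      G !=set0 -> G (x0, q x0)].

Lemma dominated_graph_max : exists G, [/\ dominated_graph G, G !=set0 &
  forall H, G `<` H -> ~ dominated_graph H].
Proof.
have [F FP Ftot|G [GP Gmax]] := @Zorn_bigcup _ dominated_graph.
  split.
  - move=> y z [G1 F1 G1y] [G2 F2 G2z].
    have [G12|G21] := Ftot _ _ F1 F2.
      by exists G2 => //; have [H _ _ _] := FP _ F2; apply: H => //; exact: G12.
    by exists G1 => //; have [H _ _ _] := FP _ F1; apply: H => //; exact: G21.
  - by move=> t y [G FG Gy]; exists G => //; have [_ H _ _] := FP _ FG; exact: H.
  - by move=> y [G FG Gy]; have [_ _ H _] := FP _ FG; exact: H.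
  - by move=> [y [G FG Gy]]; exists G => //; have [_ _ _ H] := FP _ FG; apply: H; exists y.
exists G; split => //; apply: contrapT => G0.
(* The maximal graph is not the empty one, since the real line through [x0] extends the latter. *)
pose L := [set y : V * R | exists t : R, y = (t%:C *: x0, t * q x0)].
have L0 : L (x0, q x0) by exists 1; rewrite scale1r mul1r.
apply: (Gmax L).
  split; last by move=> LG; apply: G0; exists (x0, q x0); exact: LG.
  by move=> y Gy; exfalso; apply: G0; exists y.
split => //.
- move=> _ _ [t ->] [t' ->]; exists (t + t') => /=.
  by rewrite rmorphD /= scalerDl mulrDl.
- by move=> t _ [t' ->]; exists (t * t') => /=; rewrite scalerA rmorphM mulrA.
- move=> _ [t ->] /=; rewrite (seminormZ hq) modulus_real.
  by rewrite ler_wpM2r ?(seminorm_ge0 hq)// ler_norm.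
Qed.

(** A value at [x1] must lie above every [y.2 - q (y.1 - x1)] and below every [q (y.1 + x1) - y.2].
    The triangle inequality makes these compatible, and the supremum of the former is chosen; the
    two sides handle negative and positive multiples of [x1]. *)
Lemma dominated_graph_extend G x1 : dominated_graph G -> G !=set0 ->
  exists H, [/\ dominated_graph H, G `<=` H & exists a, H (x1, a)].
Proof.
move=> [GD GZ Gq Gx0] G0.
have G00 : G (0, 0).
  by have [y /(GZ 0)] := G0; rewrite scale0r mul0r.
pose S := [set y.2 - q (y.1 - x1) | y in G].
have SB y : G y -> ubound S (q (y.1 + x1) - y.2).
  move=> Gy _ [z Gz <-]; rewrite lerBlDr addrAC lerBrDr.
  have := Gq _ (GD _ _ Gz Gy) => /= /le_trans; apply.
  have -> : z.1 + y.1 = (y.1 + x1) + (z.1 - x1) by rewrite addrACA subrr addr0 addrC.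
  exact: seminormD.
have S0 : S !=set0 by exists (0 - q (0 - x1)); exists (0, 0).
have hS : has_ubound S by exists (q (0 + x1) - 0); exact: (SB (0, 0)).
pose c := sup S.
have c1 y : G y -> y.2 - q (y.1 - x1) <= c by move=> Gy; apply: ub_le_sup => //; exists y.
have c2 y : G y -> c <= q (y.1 + x1) - y.2 by move=> Gy; apply: ge_sup => //; exact: SB.
pose H := [set z : V * R | exists y t, G y /\ z = (y.1 + t%:C *: x1, y.2 + t * c)].
have GH : G `<=` H.
  by move=> [y b] Gy; exists (y, b), 0; rewrite scale0r mul0r !addr0.
exists H; split => //; last first.
  by exists c; exists (0, 0), 1; rewrite scale1r mul1r !add0r.
split.
- move=> _ _ [y [t [Gy ->]]] [z [t' [Gz ->]]] /=.
  exists (y.1 + z.1, y.2 + z.2), (t + t'); split; first exact: GD.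
  by rewrite /= rmorphD /= scalerDl mulrDl ; congr (_, _); rewrite addrACA.
- move=> t _ [y [t' [Gy ->]]] /=; exists (t%:C *: y.1, t * y.2), (t * t'); split; first exact: GZ.
  by rewrite /= scalerDr scalerA rmorphM mulrDr mulrA.
- move=> _ [y [t [Gy ->]]] /=.
  have scale (b : R) : b != 0 -> q (y.1 + t%:C *: x1) = `|b| * q (b^-1%:C *: y.1 + (b^-1 * t)%:C *: x1).
    move=> b0; rewrite -modulus_real -(seminormZ hq) scalerDr !scalerA -!rmorphM.
    by rewrite /= mulrA divff// mul1r scale1r.
  case: (ltrgt0P t) => [t0|t0|->]; last by rewrite scale0r mul0r !addr0; exact: Gq.
    rewrite (scale t) ?gt_eqF// gtr0_norm// mulVf ?gt_eqF// scale1r.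
    have := c2 _ (GZ t^-1 _ Gy) => /=; rewrite -(ler_pM2l t0) mulrBr mulrA divff ?gt_eqF// mul1r.
    by rewrite lerBrDl.
  have t0' : 0 < - t by rewrite oppr_gt0.
  have tt : (- t)^-1 * t = -1 by rewrite invrN mulNr mulVf ?lt_eqF.
  rewrite (scale (- t)) ?gt_eqF// gtr0_norm// tt rmorphN1 scaleN1r.
  have := c1 _ (GZ (- t)^-1 _ Gy) => /=; rewrite -(ler_pM2l t0') mulrBr mulrA divff ?gt_eqF// mul1r.
  by lra.
- by move=> _; apply: GH; exact: Gx0.
Qed.

Lemma hahn_banach_real : exists g : V -> R,
  [/\ forall x y, g (x + y) = g x + g y, forall (t : R) x, g (t%:C *: x) = t * g x,
      forall x, g x <= q x & g x0 = q x0].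
Proof.
have [G [GP G0 Gmax]] := dominated_graph_max.
have tot x1 : exists a, G (x1, a).
  have [H [HP GH [a Ha]]] := dominated_graph_extend x1 GP G0.
  have [HG|nHG] := pselect (H `<=` G); first by exists a; exact: HG.
  by exfalso; apply: (Gmax H).
have [GD GZ Gq Gx0] := GP.
(* Domination alone makes the graph single-valued: the difference of two values at [x] is at most
   [q 0 = 0]. *)
have le x a b : G (x, a) -> G (x, b) -> a <= b.
  move=> Ga Gb; have := Gq _ (GD _ _ Ga (GZ (-1) _ Gb)) => /=.
  by rewrite rmorphN1 scaleN1r subrr (seminorm0 hq) mulN1r subr_le0.
have [g Gg] := choice tot.
have gE x a : G (x, a) -> g x = a.
  by move=> Ga; apply/eqP; rewrite eq_le; apply/andP; split; apply: le; eauto.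
exists g; split.
- by move=> x y; apply: gE; exact: (GD _ _ (Gg x) (Gg y)).
- by move=> t x; apply: gE; exact: (GZ t _ (Gg x)).
- by move=> x; exact: (Gq _ (Gg x)).
- by apply: gE; exact: Gx0.
Qed.

End HahnBanach.

Section Separation.
Variables (R : realType) (X : normedModType R[i]) (L : set X).
Hypothesis L_linear : forall a x y, L x -> L y -> L (a *: x + y).
Hypothesis L0 : L 0.
Let hn := @rnorm_seminorm R X.

Definition dist_subspace (x : X) : R := inf [set rnorm (x - l) | l in L].

Lemma dist_subspace_le x l : L l -> dist_subspace x <= rnorm (x - l).
Proof.
move=> Ll; apply: ge_inf; last by exists l.
by exists 0 => _ [k _ <-]; exact: (seminorm_ge0 hn).
Qed.

Lemma dist_subspace_ge x c : (forall l, L l -> c <= rnorm (x - l)) -> c <= dist_subspace x.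
Proof.
move=> h; apply: lb_le_inf; first by exists (rnorm (x - 0)); exists 0.
by move=> _ [l Ll <-]; exact: h.
Qed.

Lemma dist_subspace_seminorm : seminorm dist_subspace.
Proof.
have d0 x : 0 <= dist_subspace x.
  by apply: dist_subspace_ge => l _; exact: (seminorm_ge0 hn).
split=> [x y|a x].
  rewrite -lerBlDr; apply: dist_subspace_ge => l Ll.
  rewrite lerBlDr -lerBlDl; apply: dist_subspace_ge => k Lk.
  rewrite lerBlDl; apply: le_trans (_ : rnorm (x + y - (l + k)) <= _).
    by apply: dist_subspace_le; have := L_linear 1 Ll Lk; rewrite scale1r.
  by rewrite opprD addrACA; exact: (seminormD hn).
have le b z : dist_subspace (b *: z) <= modulus b * dist_subspace z.
  have [->|b0] := eqVneq b 0.
    rewrite scale0r modulus0 mul0r; apply: le_trans (dist_subspace_le _ L0) _.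
    by rewrite subr0 (seminorm0 hn).
  have mb : 0 < modulus b by rewrite modulus_gt0.
  rewrite -ler_pdivrMl//; apply: dist_subspace_ge => l Ll.
  rewrite ler_pdivrMl// -(seminormZ hn) scalerBr; apply: dist_subspace_le.
  by have := L_linear b Ll L0; rewrite addr0.
apply/eqP; rewrite eq_le le /=.
have [->|a0] := eqVneq a 0; first by rewrite modulus0 mul0r.
have ma : 0 < modulus a by rewrite modulus_gt0.
rewrite -ler_pdivlMl// -modulusV; apply: le_trans (le _ _).
by rewrite scalerA mulVf// scale1r.
Qed.

(** The real functional is dominated by the distance to [L], a seminorm that vanishes on [L] and is
    at least [e] at [x0]. *)
Lemma separating_functional x0 (e : R) : 0 < e -> (forall l, L l -> e <= rnorm (x0 - l)) ->
  exists phi : X -> R[i]^o,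
    [/\ bounded_linear phi, phi x0 != 0 & forall l, L l -> phi l = 0].
Proof.
move=> e0 He; have hq := dist_subspace_seminorm.
have [g [gD gZ gq gx0]] := hahn_banach_real hq x0.
have qL l : L l -> dist_subspace l = 0.
  move=> Ll; apply/eqP; rewrite eq_le (seminorm_ge0 hq) andbT.
  by have := dist_subspace_le l Ll; rewrite subrr (seminorm0 hn).
have gN x : g (- x) = - g x by have := gZ (-1) x; rewrite rmorphN1 scaleN1r mulN1r.
have gabs x : `|g x| <= dist_subspace x.
  by rewrite ler_norml gq andbT lerNl -gN -(seminormN hq).
have qrn x : dist_subspace x <= rnorm x.
  by have := dist_subspace_le x L0; rewrite subr0.
have qi x : dist_subspace ('i%C *: x) = dist_subspace x.
  by rewrite (seminormZ hq) modulus_imag normr1 mul1r.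
(* The complex-linear functional with real part [g]. *)
pose phi (x : X) : R[i]^o := g x +i* (- g ('i%C *: x)).
exists phi; split.
- split.
    move=> a x y; rewrite /phi.
    have aE : a = (complex.Re a)%:C + (complex.Im a)%:C * 'i%C by case: a => b c; simpc.
    have h1 : g (a *: x) = complex.Re a * g x + complex.Im a * g ('i%C *: x).
      by rewrite {1}aE scalerDl -scalerA gD !gZ.
    have h2 : g ('i%C *: (a *: x)) = complex.Re a * g ('i%C *: x) - complex.Im a * g x.
      have -> : 'i%C *: (a *: x) = (complex.Re a)%:C *: ('i%C *: x) + (complex.Im a)%:C *: - x.
        rewrite !scalerA scalerN -scaleNr -scalerDl; congr (_ *: _).
        by case: (a) => b c; simpc.
      by rewrite gD !gZ gN mulrN.
    rewrite scalerDr !gD h1 h2.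
    case: (a) => b c /=; rewrite /GRing.scale /=; simpc.
    by congr (_ +i* _); ring.
  exists 2 => x; rewrite /rnorm -/(modulus _).
  apply: le_trans (modulus_le _) _ => /=; rewrite normrN.
  have := gabs x; have := gabs ('i%C *: x); have := qrn x; rewrite qi.
  by lra.
- apply/eqP => /(congr1 (@complex.Re R)) /= h.
  have := dist_subspace_ge He; rewrite -gx0 h; lra.
- have g0 x : dist_subspace x = 0 -> g x = 0.
    move=> h; apply/normr0_eq0/eqP; rewrite eq_le normr_ge0 andbT.
    by have := gabs x; rewrite h.
  by move=> l Ll; rewrite /phi !g0 ?qi ?qL// oppr0.
Qed.

End Separation.

(** * Orbits of eigenvectors on the imaginary axis *)

Section GeneratorKernel.
Variables (R : realType) (X : normedModType R[i]) (T : R -> X -> X).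
Hypothesis T_semigroup : C0_semigroup T.
Let A := generator T.
Let hn := @rnorm_seminorm R X.

Lemma generator_linear a x y : dom A x -> dom A y ->
  dom A (a *: x + y) /\ A (a *: x + y) = a *: A x + A y.
Proof.
move=> dx dy; apply/generatorP => e e0.
have ma := modulus_ge0 a.
have a1 : 0 < 2 * (modulus a + 1) by rewrite mulr_gt0// ltr_wpDl.
have [/(_ (conj dx erefl) _ (divr_gt0 e0 a1))[d1 d10 H1] _] := generatorP T x (A x).
have e2 : 0 < e / 2 by rewrite divr_gt0.
have [/(_ (conj dy erefl) _ e2)[d2 d20 H2] _] := generatorP T y (A y).
exists (Num.min d1 d2); first by rewrite lt_min d10.
move=> h h0; rewrite lt_min => /andP[hd1 hd2].
have -> : difference_quotient T (a *: x + y) h - (a *: A x + A y) =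
    a *: (difference_quotient T x h - A x) + (difference_quotient T y h - A y).
  rewrite /difference_quotient (semigroup_add T_semigroup) ?(ltW h0)//.
  rewrite (semigroup_scale T_semigroup) ?(ltW h0)// opprD addrACA -scalerBr.
  rewrite scalerDr scalerA [_%:C * a]mulrC -scalerA.
  by rewrite opprD addrACA -scalerBr.
have h1 := H1 h h0 hd1; have h2 := H2 h h0 hd2.
apply: le_lt_trans (seminormD hn _ _) _; rewrite (seminormZ hn).
have p1 := seminorm_ge0 hn (difference_quotient T x h - A x).
have : modulus a * rnorm (difference_quotient T x h - A x) <= e / 2.
  apply: le_trans (_ : (modulus a + 1) * (e / (2 * (modulus a + 1))) <= _).
    by apply: ler_pM => //; [rewrite lerDl | exact: ltW].
  by rewrite le_eqVlt; apply/orP; left; apply/eqP; field; rewrite gt_eqF// ltr_wpDl.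
by lra.
Qed.

(* On an eigenvector [T h] is multiplication by [1 + i s h] up to [o(h)], of modulus [1 + o(h)]. *)
Lemma imaginary_eigenvector_orbit (u : R -> R) s x :
  (forall t y, 0 <= t -> rnorm (T t y) <= u t * rnorm y) ->
  (forall t : R, 0 <= t -> exists K, forall t' : R, 0 <= t' <= t -> u t' <= K) ->
  dom A x -> A x = (0 +i* s) *: x ->
  forall t, 0 <= t -> rnorm (T t x) <= rnorm x.
Proof.
move=> T_le u_bounded dx Ax t; rewrite le_eqVlt => /predU1P[<-|t0].
  by rewrite (semigroup0 T_semigroup).
have [K' HK'] := u_bounded t (ltW t0).
pose K := Num.max K' 1.
have K0 : 0 < K by rewrite lt_max ltr01 orbT.
have HK t' : 0 <= t' <= t -> u t' <= K.
  by move=> /HK' /le_trans; apply; rewrite le_max lexx.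
have nx := seminorm_ge0 hn x.
apply/ler_addgt0Pr => e e0.
(* After [n] steps of length [h = t / n] the error is [t * (h * s^2 * K * rnorm x + K * c)]; [c]
   makes the second term [e / 2], and [h < m] bounds the first by [e / 2]. *)
pose c := e / (2 * t * K).
have tK : 0 < 2 * t * K by rewrite !mulr_gt0.
have c0 : 0 < c by exact: divr_gt0.
have [d d0 H] := generator_approx dx c0.
pose B := s ^+ 2 * K * rnorm x + 1.
have B0 : 0 < B by rewrite ltr_wpDl// mulr_ge0// mulr_ge0 ?sqr_ge0 ?(ltW K0).
pose m := Num.min d (e / 2 / (B * t)).
have m0 : 0 < m by rewrite lt_min d0 !divr_gt0// mulr_gt0.
pose n := (Num.truncn (t / m)).+1.
have n0 : 0 < n%:R :> R by rewrite ltr0n.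
pose h := t / n%:R.
have h0 : 0 < h by rewrite divr_gt0.
have hm : h < m by rewrite ltr_pdivrMr// mulrC -ltr_pdivrMr// truncnS_gt.
have hd : h < d by apply: lt_le_trans hm _; rewrite ge_min lexx.
have [r hr Tx] := H h h0 hd.
have step j : (j < n)%N -> rnorm (T (j.+1%:R * h) x) <=
    rnorm (T (j%:R * h) x) + h * (h * (s ^+ 2 * (K * rnorm x)) + K * c).
  move=> jn; have jh0 : 0 <= j%:R * h by rewrite mulr_ge0// ltW.
  have jt : j%:R * h <= t.
    rewrite /h mulrA ler_pdivrMr// mulrC ler_pM2l// ler_nat; exact: ltnW.
  have uj : u (j%:R * h) <= K by apply: HK; rewrite jh0.
  have -> : T (j.+1%:R * h) x =
      (1 +i* (h * s)) *: T (j%:R * h) x + h%:C *: T (j%:R * h) r.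
    rewrite -natr1 mulrDl mul1r (semigroupD T_semigroup) ?(ltW h0)// Tx Ax.
    rewrite -!(semigroup_scale T_semigroup)// -(semigroup_add T_semigroup)//; congr (T _ _).
    rewrite scalerDr addrA; congr (_ + _); rewrite scalerA -{1}(scale1r x) -scalerDl.
    by congr (_ *: _); simpc.
  apply: le_trans (seminormD hn _ _) _; rewrite !(seminormZ hn) modulus_real gtr0_norm//.
  rewrite mulrDr addrA; apply: lerD; last first.
    rewrite ler_wpM2l ?(ltW h0)//; apply: le_trans (T_le _ _ jh0) _.
    apply: le_trans (_ : K * rnorm r <= _); first by rewrite ler_wpM2r// (seminorm_ge0 hn).
    by rewrite ler_wpM2l// ltW.
  have mle : modulus (1 +i* (h * s)) <= 1 + (h * s) ^+ 2.
    rewrite /modulus normc_def /= expr1n -[leRHS]ger0_norm ?addr_ge0 ?sqr_ge0//.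
    rewrite -sqrtr_sqr ler_wsqrtr// expr2 ler_peMl ?lerDl ?addr_ge0 ?sqr_ge0//.
  have nT := seminorm_ge0 hn (T (j%:R * h) x).
  apply: le_trans (_ : (1 + (h * s) ^+ 2) * rnorm (T (j%:R * h) x) <= _).
    by rewrite ler_wpM2r.
  rewrite mulrDl mul1r lerD2l mulrA -expr2 exprMn -mulrA ler_wpM2l ?sqr_ge0// ler_wpM2l ?sqr_ge0//.
  by apply: le_trans (T_le _ _ jh0) _; rewrite ler_wpM2r.
have H' j : (j <= n)%N -> rnorm (T (j%:R * h) x) <=
    rnorm x + j%:R * (h * (h * (s ^+ 2 * (K * rnorm x)) + K * c)).
  elim: j => [|j IH] jn; first by rewrite !mul0r (semigroup0 T_semigroup) addr0.
  apply: le_trans (step _ jn) _; rewrite -natr1 mulrDl mul1r addrA lerD2r.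
  by apply: IH; exact: ltnW.
have := H' n (leqnn n).
have -> : n%:R * h = t by rewrite /h mulrCA divff ?mulr1// gt_eqF.
move=> /le_trans; apply; rewrite lerD2l mulrA.
have -> : n%:R * h = t by rewrite /h mulrCA divff ?mulr1// gt_eqF.
rewrite mulrDr.
have -> : t * (K * c) = e / 2 by rewrite /c; field; rewrite !gt_eqF.
have : t * (h * (s ^+ 2 * (K * rnorm x))) <= e / 2.
  apply: le_trans (_ : t * (m * B) <= _).
    rewrite ler_wpM2l ?(ltW t0)//; apply: ler_pM; rewrite ?(ltW h0) ?(ltW hm)//.
      by rewrite mulr_ge0 ?sqr_ge0// mulr_ge0// ltW.
    by rewrite /B mulrA lerDl.
  have : m <= e / 2 / (B * t) by rewrite ge_min lexx orbT.
  rewrite ler_pdivlMr ?mulr_gt0//.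
  by rewrite (_ : m * (B * t) = t * (m * B)); last by ring.
by lra.
Qed.

End GeneratorKernel.

(** * Asymptotic shift invariance of the bounds [v] and [w] *)

Section Growth.
Variable R : realType.
Implicit Types v w : R -> R.

Lemma C0_pinfty (f : R -> R) (e : R) : C0 f -> 0 < e ->
  exists t0 : R, forall t, t0 <= t -> `|f t| <= e.
Proof.
move=> [_ /cvgrPdist_lt H _] /H [t0 [_ h]].
exists (t0 + 1) => t ht; have /= := h t; rewrite sub0r normrN => h'.
by apply/ltW/h'; apply: lt_le_trans ht; rewrite ltrDl.
Qed.

Lemma small_increments_shift v s (d : R) : (forall t, 1 <= v t) -> small_increments v ->
  0 < d -> exists t0 : R, forall t, t0 <= t ->
  (1 - d) * v t <= v (t + s) <= (1 + d) * v t.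
Proof.
move=> v1 [/(_ s) hs _] d0; have [t0 h] := C0_pinfty hs d0; exists t0 => t /h.
have vt : 0 < v t by exact: lt_le_trans (v1 t).
by rewrite /Delta normrM normfV (gtr0_norm vt) ler_pdivrMr// ler_norml; lra.
Qed.

Lemma product_shift v w s (d : R) : (forall t, 1 <= v t) -> (forall t, 1 <= w t) ->
  small_increments v -> small_increments w -> 0 < d ->
  exists t0 : R, forall t, t0 <= t ->
    v (t + s) * w (t + s) <= (1 + d) * (v t * w t) /\
    v t * w t <= (1 + d) * (v (t + s) * w (t + s)).
Proof.
move=> v1 w1 hv hw d0.
have d1 : 0 < 1 + d by rewrite addr_gt0.
(* Chosen so that both [(1 + c)^2 <= 1 + d] and [(1 + d) * (1 - c)^2 >= 1] hold. *)
pose c := d / (3 * (1 + d)).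
have c0 : 0 < c by rewrite divr_gt0// mulr_gt0.
have cd : c * (3 * (1 + d)) = d by rewrite divfK// gt_eqF// mulr_gt0.
have c3 : 3 * c <= 1 by nra.
have c3d : 3 * c <= d by nra.
have [t0 h0] := small_increments_shift s v1 hv c0.
have [t1 h1] := small_increments_shift s w1 hw c0.
exists (Num.max t0 t1) => t; rewrite ge_max => /andP[/h0/andP[a1 a2] /h1/andP[b1 b2]].
have vt := v1 t; have wt := w1 t; have vts := v1 (t + s); have wts := w1 (t + s).
have vw : 0 < v t * w t by rewrite mulr_gt0// (lt_le_trans ltr01).
split.
  apply: le_trans (_ : (1 + c) * v t * ((1 + c) * w t) <= _).
    by apply: ler_pM => //; exact: le_trans ler01 _.
  rewrite mulrACA ler_wpM2r ?(ltW vw)//.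
  nra.
have h : (1 - c) * v t * ((1 - c) * w t) <= v (t + s) * w (t + s).
  have c1 : 0 <= 1 - c by lra.
  by apply: ler_pM => //; apply: mulr_ge0 => //; exact: le_trans ler01 _.
apply: le_trans (_ : (1 + d) * ((1 - c) * v t * ((1 - c) * w t)) <= _); last first.
  by rewrite ler_wpM2l// ltW.
have -> : (1 + d) * ((1 - c) * v t * ((1 - c) * w t)) =
    ((1 + d) * (1 - c) ^+ 2) * (v t * w t) by ring.
have k1 : 1 <= (1 + d) * (1 - c) ^+ 2 by nra.
by apply: le_trans (ler_wpM2r (ltW vw) k1); rewrite mul1r.
Qed.

Lemma continuous_le_segment (u : R -> R) t : continuous u -> 0 <= t ->
  exists K, forall t' : R, 0 <= t' <= t -> u t' <= K.
Proof.
move=> cu t0; have [c _ hc] := EVT_max t0 (continuous_subspaceT cu).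
by exists (u c) => t' ht; apply: hc; rewrite in_itv.
Qed.

End Growth.

Lemma dense_rnorm (R : realType) (X : normedModType R[i]) (S : set X) x (e : R) :
  dense S -> 0 < e -> exists2 y, S y & rnorm (y - x) < e.
Proof.
move=> dS e0; have [|y [By Sy]] := dS [set y | rnorm (y - x) < e]^° _ (open_interior _).
  by exists x; apply/nbhs_rnormP; exists e.
by exists y => //; exact: interior_subset By.
Qed.

Unset Implicit Arguments.
Set Strict Implicit.
Set Printing Implicit Defensive.

Theorem theorem11p3 (R : realType) (X : completeNormedModType R[i])
    (v w : R -> R) (T : R -> X -> X) (A : operator X)
    (hv : admissible v) (hw : weight w)
    (hT : C0_semigroup T) (hA : A = generator T)
    (hu : forall t : R, 0 <= t -> opnorm (T t) <= v t * w t)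
    (hcount : countable (spectrum A `&` imaginary_axis R))
    (hcond :
      (* (a) *)
      conjugate_point_spectrum A `&` imaginary_axis R = set0 \/
      (* (b) *)
      (forall s : R, dense (oprange (opshift A (0 +i* s)))) \/
      (* (c) *)
      [/\ ~ bounded_function v \/ ~ bounded_function w,
          (exists c : R, v = cst c) \/ Cw0_Rplus w (fun t => 1 / v t) &
          forall s : R, dense [set a + b | a in opker (opshift A (0 +i* s))
                                         & b in oprange (opshift A (0 +i* s))]]) :
  forall x : X, rnorm (T t x) / (v t * w t) @[t --> +oo] --> 0.
Proof.
subst A; set A := generator T.
have v1 := admissible_ge1 hv; have w1 := weight_ge1 hw.
have hn := @rnorm_seminorm R X.
pose u t := v t * w t.
have v0 t : 0 < v t := lt_le_trans ltr01 (v1 t).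
have w0 t : 0 < w t := lt_le_trans ltr01 (w1 t).
have u0 t : 0 < u t by exact: mulr_gt0.
have T_le (t : R) x : 0 <= t -> rnorm (T t x) <= u t * rnorm x.
  move=> t0; apply: le_trans (rnorm_le_opnorm _ (semigroup_bounded hT t0)) _.
  by rewrite ler_wpM2r ?hu// (seminorm_ge0 hn).
have u_shift (s d : R) : 0 <= s -> 0 < d -> exists t0 : R, forall t, t0 <= t ->
    u (t + s) <= (1 + d) * u t /\ u t <= (1 + d) * u (t + s).
  by move=> _; exact: product_shift v1 w1 (admissible_increments hv) (weight_increments hw).
have u_cont : continuous u.
  by move=> t; apply: continuousM; [exact: admissible_continuous hv t | exact: weight_continuous hw t].
pose p := orbit_seminorm T u.
have hp : seminorm p := orbit_seminorm_seminorm hT u0 T_le.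
have p_le : forall x, p x <= rnorm x := orbit_seminorm_rnorm T_le.
have pT := orbit_seminorm_semigroup hT T_le u_shift.
have p_comm := orbit_seminorm_comm T_le.
move=> x; apply: (orbit_seminorm0_cvg u0 T_le).
move: x; apply: (orbit_seminorm_trivial hT hp p_le pT p_comm hcount) => s x e e0.
case: hcond => [ha|[hb|[hunb hvw hc]]].
- apply: contrapT => no.
  have far z : dom A z -> e <= rnorm (x - (A z - (0 +i* s) *: z)).
    move=> dz; rewrite leNgt; apply/negP => lt; apply: no; exists z; split => //.
    by apply: le_trans (p_le _) _; rewrite (seminorm_distC hn) ltW.
  have dom0 : dom A 0 /\ A 0 = 0.
    apply/generatorP => d d0; exists 1 => // h h0 _.
    by rewrite /difference_quotient (semigroup_zero hT) ?(ltW h0)// !subr0 scaler0 (seminorm0 hn).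
  pose L := oprange (opshift A (0 +i* s)).
  have L_linear a y z : L y -> L z -> L (a *: y + z).
    move=> [y' dy <-] [z' dz <-].
    have [d1 d2] := generator_linear hT a dy dz.
    exists (a *: y' + z') => //.
    suff : A (a *: y' + z') - (0 +i* s) *: (a *: y' + z') =
        a *: (A y' - (0 +i* s) *: y') + (A z' - (0 +i* s) *: z') by [].
    rewrite d2.
    rewrite !scalerBr scalerDr opprD addrACA !scalerA.
    by rewrite [a * _]mulrC.
  have L0 : L 0.
    exists 0; first exact: dom0.1.
    suff : A 0 - (0 +i* s) *: 0 = 0 by [].
    by rewrite dom0.2 scaler0 subr0.
  have Lfar l : L l -> e <= rnorm (x - l) by move=> [z dz <-]; exact: far.
  have [phi [hphi phix phiL]] := separating_functional L_linear L0 e0 Lfar.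
  have [linphi [K HK]] := hphi.
  (* Since [phi] kills the range of [A - is] and is not zero, it is an eigenvector of the conjugate
     operator for [is]. *)
  suff : set0 (0 +i* s : R[i]) by [].
  rewrite -ha; split; last by exists s.
  exists phi; split; first by move=> E; move: phix; rewrite E eqxx.
  split => //.
    split.
      by move=> a y z; rewrite linphi scalerDr !scalerA mulrC.
    exists (`|s| * K) => y.
    have /seminormZ -> := @rnorm_seminorm R (R[i]^o : normedModType R[i]).
    by rewrite modulus_imag -mulrA ler_wpM2l.
  move=> y dy; have /phiL : L (A y - (0 +i* s) *: y) by exists y.
  rewrite addrC -scaleNr linphi scaleNr => /eqP; rewrite addrC subr_eq0 => /eqP.
  by [].
- have [_ [z dz <-] hz] := dense_rnorm x (hb s) e0.
  by exists z; split => //; apply: le_trans (p_le _) (ltW hz).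
(* If [1 / v = w * xi], then [1 / u] is [xi] itself. If [v] is constant, [w] is unbounded, so
   [1 / w] is in C_0, and [1 / u <= 1 / w]. *)
have u_inf (d : R) : 0 < d -> exists t0 : R, forall t, t0 <= t -> 0 <= t -> (u t)^-1 <= d.
  move=> d0; case: hvw => [[c vc]|[xi [[_ /cvgrPdist_lt xi0] vxi]]]; last first.
    have [t0 [_ h]] := xi0 d d0; exists (t0 + 1) => t ht t1.
    have -> : (u t)^-1 = xi t.
      by rewrite /u invfM -[(v t)^-1]mul1r (vxi t t1) mulrAC divff ?mul1r// gt_eqF.
    have /= := h t (lt_le_trans _ ht); rewrite ltrDl ltr01 sub0r normrN => /(_ isT) h'.
    by apply: le_trans (ler_norm _) (ltW h').
  have nw : ~ bounded_function w.
    case: hunb => // nv _; apply: nv; rewrite vc.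
    by exists `|c|; split; [rewrite num_real | move=> M cM t _ /=; exact: ltW].
  have [wE|wC0] := weight_one_or_C0 hw.
    exfalso; apply: nw; rewrite wE.
    by exists 1; split; [rewrite num_real | move=> M cM t _ /=; rewrite normr1; exact: ltW].
  have [t0 h] := C0_pinfty wC0 d0; exists t0 => t ht _.
  apply: le_trans (_ : (w t)^-1 <= _).
    by rewrite lef_pV2 ?posrE ?u0 ?w0// ler_peMl ?(ltW (w0 t)).
  by apply: le_trans (h t ht); rewrite div1r ler_norm.
have [_ [a [da /= Aa] [_ [z dz <-] <-]] hz] := dense_rnorm x (hc s) e0.
exists z; split => //.
(* The orbit of the kernel vector [a] is bounded by [rnorm a], so dividing by [u] sends it to 0;
   hence [z] alone already solves the equation for [p]. *)
have pa : p a <= 0.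
  apply/ler_addgt0Pr => d d0; rewrite add0r; apply: orbit_seminorm_le.
  split; first exact: ltW.
  have na := seminorm_ge0 hn a.
  have a1 : 0 < rnorm a + 1 by rewrite ltr_wpDl.
  have [t0 h] := u_inf _ (divr_gt0 d0 a1); exists t0 => t ht t1.
  have Aa' : A a = (0 +i* s) *: a by apply/eqP; rewrite -subr_eq0; apply/eqP.
  apply: le_trans (imaginary_eigenvector_orbit hT T_le _ da Aa' t1) _.
    by move=> t' ht'; exact: continuous_le_segment.
  have := h t ht t1; rewrite -[(u t)^-1]mul1r ler_pdivrMr// mulrAC ler_pdivlMr// mul1r.
  by apply: le_trans; rewrite lerDl.
have -> : A z - (0 +i* s) *: z - x = a + (A z - (0 +i* s) *: z) - x - a.
  by move: (A z - _) => y; rewrite [RHS]addrAC [a + y]addrC addrK.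
apply: le_trans (seminormB hp _ _) _.
apply: le_trans (_ : e + 0 <= _); last by rewrite addr0.
by apply: lerD => //; apply: le_trans (p_le _) (ltW hz).
Qed.
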